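(* Let $\Omega\subset\mathbb{R}^d$ be a domain (not necessarily bounded) and let $V$ be a real potential on $\Omega$. Assume that $H=-\Delta+V(x)$ is essentially self-adjoint on $C_c^\infty(\Omega)$; has purely discrete spectrum $\lambda_1\le\lambda_2\le\cdots$ with $\lambda_1>-\infty$; and that for some constant $\sigma<\infty$ one has $T_k\le\sigma\,\lambda_k$ for all $k$. Then: (a) For $\rho\ge 2$ and $z\ge 0$, $$R_\rho(z)\le\frac{\rho}{\rho+\frac{d}{2\sigma}}\,z\,R_{\rho-1}(z),$$ and consequently the function $z\mapsto \dfrac{R_\rho(z)}{z^{\rho+\frac{d}{2\sigma}}}$ is a nondecreasing function of $z>0$. (b) For $1<\rho\le 2$ and $z\ge 0$, $$R_\rho(z)\le\frac{1}{1+\frac{d}{4\sigma}}\,z\,R_{\rho-1}(z),$$ and consequently the function $z\mapsto \dfrac{R_\rho(z)}{z^{\rho+\frac{d\rho}{4\sigma}}}$ is a nondecreasing function of $z>0$.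
   Context: The eigenvalues $\lambda_k$ of $H$ are counted with multiplicity and ordered increasingly, tending to $\infty$; $\{u_k\}$ is a corresponding complete orthonormal family of eigenfunctions in $L^2(\Omega)$. The kinetic energies are $T_k:=\int_\Omega|\nabla u_k|^2\,dx=\lambda_k-\int_\Omega V(x)|u_k|^2\,dx$. For $\rho>0$, $R_\rho(z)=\sum_k(z-\lambda_k)_+^\rho$ with $(x)_+=\max(0,x)$. *)

(* Defs.v *)
From HB Require Import structures.
From mathcomp Require Import all_boot all_order all_algebra.
From mathcomp Require Import all_classical all_reals all_analysis.
From mathcomp Require Import complex.

Set Implicit Arguments.
Unset Strict Implicit.
Unset Printing Implicit Defensive.
Import Order.TTheory GRing.Theory Num.Theory.
Import numFieldNormedType.Exports.

Local Open Scope classical_set_scope.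
Local Open Scope ring_scope.

(* The sigma-algebra on row vectors is generated by the coordinates; it is the
   Borel sigma-algebra. *)
Section MeasurableRV.
Context {R : realType} (n : nat).

Let coors : 'I_n -> 'rV[R]_n -> R := fun i v => v ord0 i.

Let rV_set0 : g_sigma_preimage coors set0.
Proof. exact: sigma_algebra0. Qed.

Let rV_setC A : g_sigma_preimage coors A -> g_sigma_preimage coors (~` A).
Proof. exact: sigma_algebraC. Qed.

Let rV_bigcup (F : _^nat) : (forall i, g_sigma_preimage coors (F i)) ->
  g_sigma_preimage coors (\bigcup_i (F i)).
Proof. exact: sigma_algebra_bigcup. Qed.

HB.instance Definition _ := @isMeasurable.Build default_measure_display
  'rV[R]_n (g_sigma_preimage coors) rV_set0 rV_setC rV_bigcup.

Lemma measurable_coord i :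
  measurable_fun [set: 'rV[R]_n] (fun v => v ord0 i : R).
Proof.
move=> _ Y mY; rewrite setTI; apply: sub_sigma_algebra => /=.
rewrite -bigcup_seq/=; exists i => /=; first by rewrite mem_index_enum.
by exists Y => //; rewrite setTI.
Qed.
End MeasurableRV.

Section LebesgueRV.
Variable R : realType.

Lemma measurable_rVP d (T : measurableType d) n (f : T -> 'rV[R]_n) :
  (forall i, measurable_fun [set: T] (fun x => f x ord0 i : R)) ->
  measurable_fun [set: T] f.
Proof.
move=> mf.
suff : measurable `<=` [set A : set 'rV[R]_n | measurable (f @^-1` A)].
  by move=> H _ A mA; rewrite setTI; exact: H.
apply: smallest_sub => /=.
  split => /=.
  - by rewrite preimage_set0.
  - by move=> A mA; rewrite setTD preimage_setC; exact: measurableC.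
  - by move=> F mF; rewrite preimage_bigcup; exact: bigcup_measurable.
move=> A; rewrite -bigcup_seq => -[i _ [B mB <-]] /=.
by rewrite setTI -[X in measurable X]setTI; exact: mf.
Qed.

Definition cons_rV n (p : measurableTypeR R * 'rV[R]_n) : 'rV[R]_n.+1 :=
  row_mx p.1%:M p.2.

Definition uncons_rV n (v : 'rV[R]_n.+1) : measurableTypeR R * 'rV[R]_n :=
  (v ord0 ord0, \row_i v ord0 (lift ord0 i)).

Lemma cons_rV0 n p : @cons_rV n p ord0 ord0 = p.1.
Proof.
rewrite /cons_rV (_ : ord0 = lshift n (ord0 : 'I_1)); last exact/val_inj.
by rewrite (row_mxEl p.1%:M) mxE eqxx mulr1n.
Qed.

Lemma cons_rV_lift n p i : @cons_rV n p ord0 (lift ord0 i) = p.2 ord0 i.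
Proof.
rewrite /cons_rV (_ : lift ord0 i = rshift 1 i); last exact/val_inj.
by rewrite (row_mxEr p.1%:M).
Qed.

Lemma uncons_rVK n : cancel (@uncons_rV n) (@cons_rV n).
Proof.
move=> v; apply/rowP => i; case: (unliftP ord0 i) => [j|] ->.
  by rewrite cons_rV_lift mxE.
by rewrite cons_rV0.
Qed.

Lemma cons_rVK n : cancel (@cons_rV n) (@uncons_rV n).
Proof.
move=> [x v]; rewrite /uncons_rV cons_rV0; congr pair.
by apply/rowP => i; rewrite mxE cons_rV_lift.
Qed.

Lemma measurable_cons_rV n :
  measurable_fun [set: measurableTypeR R * 'rV[R]_n] (@cons_rV n).
Proof.
apply: measurable_rVP => i; case: (unliftP ord0 i) => [j|] ->.
  rewrite (_ : (fun p => _) = (fun v : 'rV[R]_n => v ord0 j : R) \o snd).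
    by apply: measurableT_comp => //; exact: measurable_coord.
  by apply/funext => p; rewrite cons_rV_lift.
rewrite (_ : (fun p => _) = fst); first exact: measurable_fst.
by apply/funext => p; rewrite cons_rV0.
Qed.

Lemma measurable_uncons_rV n : measurable_fun [set: 'rV[R]_n.+1] (@uncons_rV n).
Proof.
apply: measurable_fun_pair; first exact: measurable_coord.
apply: measurable_rVP => i.
rewrite (_ : (fun v => _) = fun v : 'rV[R]_n.+1 => v ord0 (lift ord0 i) : R).
  exact: measurable_coord.
by apply/funext => v; rewrite mxE.
Qed.

Section step.
Variables (n : nat) (m : {sigma_finite_measure set 'rV[R]_n -> \bar R}).

Definition lebesgue_rV_step : set 'rV[R]_n.+1 -> \bar R :=
  pushforward (@lebesgue_measure R \x m)%E (@cons_rV n).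

HB.instance Definition _ := Measure.copy lebesgue_rV_step
  (measure_function_pushforward__canonical__measure_function_Measure
    (@lebesgue_measure R \x m)%E (@measurable_cons_rV n)).

Let lebesgue_rV_step_sigma_finite : sigma_finite setT lebesgue_rV_step.
Proof.
have /sigma_finiteP[F [TF ndF Foo]] := sigma_finiteT (@lebesgue_measure R).
have /sigma_finiteP[G [TG ndG Goo]] := sigma_finiteT m.
exists (fun k => @uncons_rV n @^-1` (F k `*` G k)).
  rewrite -preimage_bigcup; apply/seteqP; split => // v _ /=.
  have [k _ Fk] : (\bigcup_k F k) (uncons_rV v).1 by rewrite -TF.
  have [l _ Gl] : (\bigcup_k G k) (uncons_rV v).2 by rewrite -TG.
  exists (maxn k l) => //; split.
    by move: Fk; exact/subsetPset/ndF/leq_maxl.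
  by move: Gl; exact/subsetPset/ndG/leq_maxr.
move=> k; have [mF Fk] := Foo k; have [mG Gk] := Goo k; split.
  rewrite -[X in measurable X]setTI; apply: measurable_uncons_rV => //.
  exact: measurableX.
rewrite /lebesgue_rV_step /pushforward -comp_preimage.
rewrite (_ : _ \o _ = id); last by apply/funext => p /=; rewrite cons_rVK.
by rewrite preimage_id product_measure1E// lte_mul_pinfty// ge0_fin_numE.
Qed.

HB.instance Definition _ := Measure_isSigmaFinite.Build _ _ _ lebesgue_rV_step
  lebesgue_rV_step_sigma_finite.

End step.

(* Lebesgue measure on R^n (its values on boxes: lebesgue_rV_box) *)
Fixpoint lebesgue_rV n : {sigma_finite_measure set 'rV[R]_n -> \bar R} :=
  if n is n'.+1 then lebesgue_rV_step (lebesgue_rV n')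
  else \d_(0 : 'rV[R]_0).

End LebesgueRV.
Lemma lebesgue_rV_box (R : realType) n (B : 'I_n -> set (measurableTypeR R)) :
  (forall i, measurable (B i)) ->
  lebesgue_rV R n [set v : 'rV[R]_n | forall i, B i (v ord0 i)] =
  (\prod_(i < n) lebesgue_measure (B i))%E.
Proof.
elim: n B => [|n IH] B mB /=.
  rewrite big_ord0 diracE (_ : _ \in _ = true)//.
  by apply/mem_set => -[].
rewrite big_ord_recl -(IH (fun i => B (lift ord0 i)))//.
rewrite -product_measure1E//; last first.
  suff -> : (fun v : 'rV[R]_n => forall i, B (lift ord0 i) (v ord0 i)) =
      \bigcap_(i in [set: 'I_n])
        ((fun v : 'rV[R]_n => v ord0 i : R) @^-1` B (lift ord0 i)).
    apply: fin_bigcap_measurable => // i _.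
    rewrite -[X in measurable X]setTI.
    exact: (measurable_coord i measurableT (mB (lift ord0 i))).
  by apply/seteqP; split => v /= H i; [move=> _|]; exact: H.
rewrite /lebesgue_rV_step /pushforward.
congr (_ _); apply/seteqP; split => -[x v] /= H.
  split => /= [|i]; last by have := H (lift ord0 i); rewrite cons_rV_lift.
  by have := H ord0; rewrite cons_rV0.
move=> i; case: (unliftP ord0 i) => [j|] ->.
  by rewrite cons_rV_lift; exact: H.2.
by rewrite cons_rV0; exact: H.1.
Qed.

Section ComplexFunctions.
Variables (R : realType) (d : nat).
Local Notation E := 'rV[R]_d.
Local Notation C := R[i].
Local Notation mu := (lebesgue_rV R d).
Implicit Types (Om : set E) (f g u phi : E -> C) (z : C).

(* The norm of R[i] takes its values in R[i]; this is |z|^2 as a real. *)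
Definition sqmod z : R := complex.Re z ^+ 2 + complex.Im z ^+ 2.

Definition cmeasurable Om f : Prop :=
  measurable_fun Om (fun x => complex.Re (f x) : R) /\
  measurable_fun Om (fun x => complex.Im (f x) : R).

Definition cintegral Om f : C :=
  Complex (\int[mu]_(x in Om) complex.Re (f x))
          (\int[mu]_(x in Om) complex.Im (f x)).

(* Elements of L^2(Om) are represented by functions on the whole space, of
   which only the values on Om matter, up to a null set. *)
Definition sqnorm Om f : \bar R := (\int[mu]_(x in Om) (sqmod (f x))%:E)%E.

Definition in_L2 Om f : Prop := cmeasurable Om f /\ (sqnorm Om f < +oo)%E.

Definition eq_L2 Om f g : Prop := sqnorm Om (fun x => f x - g x) = 0%E.

Definition inner Om f g : C := cintegral Om (fun x => f x * conjc (g x)).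

Definition in_L1loc Om f : Prop := cmeasurable Om f /\
  forall K, compact K -> K `<=` Om ->
    (\int[mu]_(x in K) (Num.sqrt (sqmod (f x)))%:E < +oo)%E.

Definition partial_deriv (i : 'I_d) f : E -> C := fun x =>
  Complex ('D_(delta_mx ord0 i : E) (fun y => complex.Re (f y) : R^o) x)
          ('D_(delta_mx ord0 i : E) (fun y => complex.Im (f y) : R^o) x).

Definition laplacian f : E -> C := fun x =>
  \sum_(i < d) partial_deriv i (partial_deriv i f) x.

(* C^oo: all iterated partial derivatives exist and are differentiable. *)
Definition smooth f : Prop := forall (s : seq 'I_d) (x : E),
  differentiable (fun y => complex.Re (foldr partial_deriv f s y) : R^o) x /\
  differentiable (fun y => complex.Im (foldr partial_deriv f s y) : R^o) x.

Definition test_function Om phi : Prop :=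
  [/\ smooth phi, compact (closure [set x | phi x != 0]) &
      closure [set x | phi x != 0] `<=` Om].

Definition weak_gradient Om u (g : 'I_d -> E -> C) : Prop :=
  in_L1loc Om u /\ forall i, in_L1loc Om (g i) /\
    forall phi, test_function Om phi ->
      cintegral Om (fun x => u x * partial_deriv i phi x) =
      - cintegral Om (fun x => g i x * phi x).

(* T = \int_Om |grad u|^2, where g is the gradient of u. *)
Definition kinetic_energy Om (g : 'I_d -> E -> C) : \bar R :=
  (\int[mu]_(x in Om) (\sum_(i < d) sqmod (g i x))%:E)%E.

(* Operators in L^2(Om) are represented by their graphs. *)
Definition op_graph := (E -> C) -> (E -> C) -> Prop.
Implicit Types T : op_graph.

Definition op_closure Om T : op_graph := fun f h => [/\ in_L2 Om f, in_L2 Om h &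
  forall e : R, 0 < e -> exists f' h', [/\ T f' h',
    (sqnorm Om (fun x => f x - f' x)%R < e%:E)%E &
    (sqnorm Om (fun x => h x - h' x)%R < e%:E)%E]].

Definition op_adjoint Om T : op_graph := fun f h => [/\ in_L2 Om f, in_L2 Om h &
  forall f' h', T f' h' -> inner Om h' f = inner Om f' h].

Definition self_adjoint Om T : Prop := forall f h, T f h <-> op_adjoint Om T f h.

(* -Delta + V with domain C_c^oo(Om) *)
Definition schrodinger Om (V : E -> R) : op_graph := fun phi h =>
  test_function Om phi /\
  h = fun x => - laplacian phi x + Complex (V x) 0 * phi x.

(* The first clause says that T maps its domain into L^2(Om); for
   T = schrodinger Om V it amounts to V being in L^2_loc(Om).  The domain
   C_c^oo(Om) of the latter is dense, so that op_adjoint is single-valued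
   there. *)
Definition essentially_self_adjoint Om T : Prop :=
  (forall f h, T f h -> in_L2 Om f /\ in_L2 Om h) /\
  self_adjoint Om (op_closure Om T).

Definition eigenfunction T z f : Prop := T f (fun x => z * f x).

(* z is in the resolvent set when T - z is a bijection onto L^2(Om) with a
   bounded inverse; boundedness below yields injectivity. *)
Definition resolvent_set Om T z : Prop :=
  (exists c : R, forall f h, T f h ->
    (sqnorm Om f <= c%:E * sqnorm Om (fun x => h x - z * f x)%R)%E) /\
  (forall g, in_L2 Om g ->
    exists f h, T f h /\ eq_L2 Om g (fun x => h x - z * f x)).

Definition spectrum Om T z : Prop := ~ resolvent_set Om T z.

Definition finite_multiplicity Om T z : Prop :=
  exists n (v : 'I_n -> E -> C), (forall i, in_L2 Om (v i)) /\
    forall f, eigenfunction T z f ->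
      exists c : 'I_n -> C, eq_L2 Om f (fun x => \sum_(i < n) c i * v i x).

Definition purely_discrete_spectrum Om T : Prop :=
  forall z, spectrum Om T z ->
    [/\ exists2 e : R, 0 < e &
          forall w, spectrum Om T w -> sqmod (w - z) < e -> w = z,
        exists f, eigenfunction T z f /\ ~ eq_L2 Om f (fun=> 0) &
        finite_multiplicity Om T z].

Definition orthonormal_family Om (u : nat -> E -> C) : Prop :=
  (forall k, in_L2 Om (u k)) /\
  forall j k, inner Om (u j) (u k) = (j == k)%:R.

(* The finite linear combinations of the u k are dense in L^2(Om). *)
Definition complete_family Om (u : nat -> E -> C) : Prop :=
  forall f, in_L2 Om f -> forall e : R, 0 < e ->
    exists n (c : nat -> C),
      (sqnorm Om (fun x => f x - \sum_(k < n) c k * u k x)%R < e%:E)%E.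

(* Completeness makes lam list every eigenvalue with its multiplicity. *)
Definition eigenbasis Om T (lam : nat -> R) (u : nat -> E -> C) : Prop :=
  [/\ forall k, eigenfunction T (Complex (lam k) 0) (u k),
      orthonormal_family Om u & complete_family Om u].

End ComplexFunctions.

(* Used with rho > 0 and lam tending to +oo only: the sum is then finite. *)
Definition riesz_mean (R : realType) (lam : nat -> R) (rho z : R) : R :=
  limn (series (fun k => Num.max 0 (z - lam k) `^ rho)).

(* Main.v *)
(* Commute H with the plane waves e_t = exp(i t x_i), which are bounded and
   smooth, so that they preserve test functions and L^2 on any domain, and
   [H, e_t] u = e_t (t^2 u - 2 i t d_i u).  With
   w_jk = |<e_t u_j, u_k>|^2 + |<e_{-t} u_j, u_k>|^2, which is symmetric in j and
   k, Parseval and Bessel give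
     sum_k (lam_k - lam_j) w_jk = 2 t^2,
     sum_k (lam_k - lam_j)^2 w_jk <= 2 t^2 (t^2 + 4 |d_i u_j|^2).
   Multiply the first rule by f(lam_j) = (z - lam_j)_+^rho, sum over j,
   antisymmetrize in j and k, and use
     x^rho - y^rho <= c (x^(rho-1) + y^(rho-1)) (x - y)   for x >= y >= 0,
   with c = rho/2 if rho >= 2 and c = 1 if rho <= 2.  The second rule bounds the
   result; letting t -> 0 and summing over i,
     d R_rho <= 4 c sum_j (z - lam_j)_+^(rho-1) T_j
             <= 4 c sigma (z R_(rho-1) - R_rho).
   Since R_rho' = rho R_(rho-1), this also gives the monotonicity. *)

Require Import Defs.
From HB Require Import structures.
From mathcomp Require Import all_boot all_order all_algebra.
From mathcomp Require Import all_classical all_reals all_analysis.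
From mathcomp Require Import measurable_realfun complex ring lra.

Set Implicit Arguments.
Unset Strict Implicit.
Unset Printing Implicit Defensive.
Import Order.TTheory GRing.Theory Num.Theory.
Import numFieldNormedType.Exports.

Local Open Scope classical_set_scope.
Local Open Scope ring_scope.

(** * Powers of the positive part *)

Section Powers.
Variable R : realType.
Implicit Types a b p r x y : R.

Lemma ge0_derive_le (f df : R -> R) a b : a <= b ->
  (forall x, a <= x <= b -> is_derive x 1 f (df x)) ->
  (forall x, a < x < b -> 0 <= df x) -> f a <= f b.
Proof.
move=> ab fdf df0.
apply: (@ger0_derive1_ndecr _ f a b) => //.
- move=> x; rewrite in_itv/= => /andP[ax xb].
  by have [] := fdf x; rewrite ?ltW.
- move=> x; rewrite in_itv/= => /andP[ax xb].
  have [_ dfx] : is_derive x 1 f (df x) by apply: fdf; rewrite !ltW.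
  by rewrite derive1E dfx df0 ?ax.
- apply: derivable_within_continuous => x; rewrite in_itv/= => axb.
  by have [] := fdf x axb.
Qed.

(* Weighted AM-GM for y / x and 1. *)
Lemma powR_tangent p x y : 1 <= p -> 0 < x -> 0 <= y ->
  x `^ p + p * x `^ (p - 1) * (y - x) <= y `^ p.
Proof.
move=> p1 x0 y0.
have [->|pN1] := eqVneq p 1.
  by rewrite subrr powRr0 !mul1r !powRr1 ?(ltW x0)// subrKC.
have {p1 pN1}p1 : 1 < p by rewrite lt_neqAle eq_sym pN1.
have p0 : 0 < p by rewrite (lt_trans ltr01).
have q0 : 0 < 1 - p^-1 by rewrite subr_gt0 invf_lt1.
have t0 : 0 <= y / x by rewrite divr_ge0 ?(ltW x0).
have := @conjugate_powR _ (y / x) 1 p (1 - p^-1)^-1 t0 ler01 p0.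
rewrite invr_gt0 invrK powR1 mulr1 mul1r => /(_ q0 (subrKC _ _)) H.
have xp : 0 < x `^ p by exact: powR_gt0.
have -> : x `^ (p - 1) = x `^ p / x.
  by rewrite powRB ?powRr1 ?ltW// (gt_eqF x0) implybT.
have -> : y `^ p = (y / x) `^ p * x `^ p.
  by rewrite -powRM ?(ltW x0)// mulfVK ?gt_eqF.
have -> : x `^ p + p * (x `^ p / x) * (y - x) =
    (1 + p * (y / x - 1)) * x `^ p by field; rewrite gt_eqF.
rewrite ler_pM2r//.
move: H => /(ler_wpM2l (ltW p0)).
have -> : p * ((y / x) `^ p / p + (1 - p^-1)) = (y / x) `^ p + p - 1.
  by field; rewrite gt_eqF.
lra.
Qed.

(** The trapezoidal rule overestimates the integral of [r * x ^ (r - 1)] over [[b, a]], because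
    [x ^ (r - 1)] is convex for [r >= 2]. *)
Lemma powR_trapezoid r a b : 2 <= r -> 0 <= b -> b <= a ->
  a `^ r - b `^ r <= r / 2 * (a `^ (r - 1) + b `^ (r - 1)) * (a - b).
Proof.
(* Powers are differentiated at positive points only, so [b = 0] is settled directly, by
   [1 <= r / 2]. *)
move=> r2; rewrite le_eqVlt => /predU1P[<- a0|b0 ab].
  rewrite !powR0 ?gt_eqF; try lra.
  rewrite addr0 !subr0 -mulrA [_ * a]mulrC mulr_powRB1//; last lra.
  by rewrite ler_peMl ?powR_ge0//; lra.
(* Up to a constant, [f] is the excess of the trapezoid over [[b, x]]. Its derivative is [r / 2]
   times the height at [b] of [x ^ (r - 1)] above its tangent at [x]. *)
pose f x := r / 2 * (x `^ (r - 1) + b `^ (r - 1)) * (x - b) - x `^ r.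
pose df x := r / 2 * (b `^ (r - 1) - x `^ (r - 1) -
  (r - 1) * x `^ (r - 2) * (b - x)).
suff : f b <= f a by rewrite /f subrr mulr0 sub0r; lra.
apply: (@ge0_derive_le f df) => // x /andP[bx xa].
  have x0 : 0 < x by rewrite (lt_le_trans b0).
  have ? := is_derive1_powR r x0; have ? := is_derive1_powR (r - 1) x0.
  apply: is_derive_eq; rewrite /df/= !(scaler0, addr0, subr0) /GRing.scale/=.
  by rewrite (_ : r - 1 - 1 = r - 2); [field|ring].
have x0 : 0 < x by rewrite (lt_trans b0).
rewrite mulr_ge0 ?divr_ge0//; try lra.
have := @powR_tangent (r - 1) x b _ x0 (ltW b0).
rewrite (_ : r - 1 - 1 = r - 2); last ring.
by move=> /(_ _)/wrap[]; lra.
Qed.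

(** Expanding the product leaves [b * a ^ (r - 1) <= a * b ^ (r - 1)], which after splitting off the
    factors of exponent [r - 1] is [b ^ (2 - r) <= a ^ (2 - r)]. *)
Lemma powR_sub_le r a b : 1 < r <= 2 -> 0 <= b -> b <= a ->
  a `^ r - b `^ r <= (a `^ (r - 1) + b `^ (r - 1)) * (a - b).
Proof.
move=> /andP[r1 r2] b0 ab.
have a0 : 0 <= a by rewrite (le_trans b0).
have r0 : 0 < r by lra.
rewrite -(mulr_powRB1 a0 r0) -(mulr_powRB1 b0 r0).
suff : b * a `^ (r - 1) <= a * b `^ (r - 1) by lra.
move: b0 ab; rewrite le_eqVlt => /predU1P[<- _|b0 ab].
  by rewrite mul0r mulr_ge0 ?powR_ge0.
have {a0}a0 : 0 < a by rewrite (lt_le_trans b0).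
have E x : 0 < x -> x = x `^ (2 - r) * x `^ (r - 1).
  move=> x0; rewrite -powRD; last by rewrite (gt_eqF x0) implybT.
  by rewrite (_ : 2 - r + (r - 1) = 1) ?powRr1 ?ltW//; ring.
suff : b `^ (2 - r) * b `^ (r - 1) * a `^ (r - 1) <=
    a `^ (2 - r) * a `^ (r - 1) * b `^ (r - 1) by rewrite -!E.
rewrite [leRHS]mulrAC -!mulrA ler_wpM2r//.
  by rewrite mulr_ge0 ?powR_ge0.
by rewrite ge0_ler_powR ?nnegrE ?(ltW a0) ?(ltW b0)//; lra.
Qed.

(** The summand of [riesz_mean]. Zero to the power zero is 1, so it vanishes for [x <= 0] only if
    the exponent is nonzero; [1 < r] below keeps [r - 1] positive. *)
Definition posR_pow r x := Num.max 0 x `^ r.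

Lemma posR_powE r x : 0 <= x -> posR_pow r x = x `^ r.
Proof. by move=> x0; rewrite /posR_pow max_r. Qed.

Lemma posR_pow0 r x : 0 < r -> x <= 0 -> posR_pow r x = 0.
Proof. by move=> r0 x0; rewrite /posR_pow max_l ?powR0 ?gt_eqF. Qed.

Lemma posR_pow_ge0 r x : 0 <= posR_pow r x. Proof. exact: powR_ge0. Qed.

Lemma is_derive_posR_pow r x : 1 < r ->
  is_derive x 1 (posR_pow r) (r * posR_pow (r - 1) x).
Proof.
move=> r1; have r0 : 0 < r by lra.
have [x0|x0|->] := ltgtP x 0.
- rewrite (@posR_pow0 (r - 1)) ?ltW ?subr_gt0// mulr0.
  apply: (@near_eq_is_derive _ _ _ (cst 0)).
  near=> y; rewrite posR_pow0// ltW//; near: y; exact: lt_nbhsl.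
- rewrite posR_powE ?ltW//; have D := is_derive1_powR r x0; apply: (near_eq_is_derive _ D).
  near=> y; rewrite posR_powE// ltW//; near: y; exact: lt_nbhsr.
(* At the kink the difference quotient is 0 for [h < 0] and [h ^ (r - 1)] for [h > 0]; it tends to 0
   since [r > 1]. *)
- rewrite (@posR_pow0 (r - 1)) ?subr_gt0// mulr0.
  suff H : h^-1 *: ((posR_pow r \o shift 0) (h *: 1) - posR_pow r 0)
      @[h --> 0^'] --> (0 : R) by split; [exact: cvgP H|exact: cvg_lim H].
  apply/cvgr0Pnorm_lt => e e0; near=> h => /=.
  rewrite addr0 [h *: 1]mulr1 (@posR_pow0 r 0)// subr0 /GRing.scale/=.
  have h0 : h != 0 by near: h; exact: nbhs_dnbhs_neq.
  have hd : `|h| < e `^ (r - 1)^-1.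
    by near: h; apply: dnbhs0_lt; rewrite powR_gt0.
  have [hN|hP] := leP h 0; first by rewrite posR_pow0// mulr0 normr0.
  rewrite posR_powE ?ltW// -mulr_powRB1 ?ltW// mulKf//.
  rewrite ger0_norm ?powR_ge0//.
  have -> : e = (e `^ (r - 1)^-1) `^ (r - 1).
    by rewrite -powRrM mulVf ?powRr1 ?(ltW e0)// subr_eq0 gt_eqF.
  rewrite gt0_ltr_powR ?nnegrE ?powR_ge0 ?(ltW hP)//; first lra.
  by rewrite gtr0_norm in hd.
Unshelve. all: by end_near. Qed.

(* The sign of b is free: a pair with b < 0 <= a is handled by a <= a - b. *)
Lemma posR_pow_antisym (r C a b : R) : 1 < r -> 1 <= C ->
  (forall x y : R, 0 <= y -> y <= x -> x `^ r - y `^ r <=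
     C * (x `^ (r - 1) + y `^ (r - 1)) * (x - y)) ->
  (posR_pow r a - posR_pow r b) * (a - b) <=
  C * (posR_pow (r - 1) a + posR_pow (r - 1) b) * (a - b) ^+ 2.
Proof.
move=> r1 C1 HC.
wlog ab : a b / b <= a.
  move=> W; have [/W//|/ltW/W] := leP b a.
  have -> : (b - a) ^+ 2 = (a - b) ^+ 2 by ring.
  by rewrite [posR_pow (r - 1) b + _]addrC; lra.
have r0 : 0 < r by lra. have r10 : 0 < r - 1 by lra.
rewrite expr2 mulrA ler_wpM2r ?subr_ge0//.
have [b0|b0] := leP 0 b.
  by rewrite !posR_powE// ?(le_trans b0)//; exact: HC.
have bl := ltW b0.
rewrite [posR_pow r b]posR_pow0// [posR_pow (r - 1) b]posR_pow0// subr0 addr0.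
have [a0|a0] := leP 0 a; last by rewrite !posR_pow0 ?(ltW a0)// mulr0 mul0r.
rewrite !posR_powE// -mulr_powRB1// mulrC.
apply: (@le_trans _ _ (a `^ (r - 1) * (a - b))).
  by rewrite ler_wpM2l ?powR_ge0//; lra.
by rewrite ler_wpM2r ?subr_ge0// ler_peMl ?powR_ge0.
Qed.

End Powers.

(** * Riesz means as finite sums, monotone ratios and the abstract sum-rule inequality *)

Section RieszMeans.
Variable R : realType.
Implicit Types (lam : nat -> R) (r z : R).

Lemma cvg_pinfty_ge lam z : lam k @[k --> \oo] --> +oo ->
  exists N, forall k, (N <= k)%N -> z <= lam k.
Proof.
move=> /cvgryPge/(_ z)[N _ HN]; exists N => k Nk; exact: HN.
Qed.

(** The partial sums are constant from [n] on. Any admissible [n] will do, so that one truncation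
    can serve several exponents and all smaller [z]. *)
Lemma riesz_meanE lam r z n : 0 < r ->
  (forall k, (n <= k)%N -> z <= lam k) ->
  riesz_mean lam r z = \sum_(k < n) posR_pow r (z - lam k).
Proof.
move=> r0 H; apply/cvg_lim => //; apply: cvg_near_cst.
exists n => // m /= nm; rewrite /series/= big_mkord -(subnKC nm) big_split_ord/=.
rewrite [X in _ + X]big1 ?addr0// => i _.
by apply: posR_pow0 => //; rewrite subr_le0 H// leq_addr.
Qed.

Lemma is_derive_riesz_sum lam r n z : 1 < r ->
  is_derive z 1 (fun x => \sum_(k < n) posR_pow r (x - lam k))
    (r * \sum_(k < n) posR_pow (r - 1) (z - lam k)).
Proof.
move=> r1; rewrite mulr_sumr.
have -> : (fun x => \sum_(k < n) posR_pow r (x - lam k)) =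
    \sum_(k < n) (fun x => posR_pow r (x - lam k)).
  by apply/funext => x; rewrite fct_sumE.
apply: is_derive_sum => k.
have D1 := @is_derive_posR_pow _ r (z - lam k) r1.
have D2 : is_derive z 1 (fun x => x - lam k) (1 : R).
  by apply: is_derive_eq; rewrite subr0.
have D := @is_derive1_comp R (posR_pow r) (fun x => x - lam k) z _ _ D1 D2.
by apply: (is_derive_eq D); rewrite mulr1.
Qed.

(** The derivative of the Riesz mean of order [r] is [r] times that of order [r - 1], hence at least
    [r / (c * z)] times the mean itself. So dividing by [z ^ (r / c)] leaves a nonnegative
    derivative. *)
Lemma riesz_mean_ratio_nondecreasing lam r c :
  lam k @[k --> \oo] --> +oo -> 1 < r -> 0 < c ->
  (forall z, 0 <= z ->
     riesz_mean lam r z <= c * z * riesz_mean lam (r - 1) z) ->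
  {in `]0, +oo[ &, {homo (fun z => riesz_mean lam r z / z `^ (r / c)) :
     y z / y <= z}}.
Proof.
move=> lamy r1 c0 H y z; rewrite !in_itv/= !andbT => y0 _ yz.
have r0 : 0 < r by lra. have r10 : 0 < r - 1 by lra.
(* Truncating at the right end [z] is valid on all of [[y, z]], so the means can be differentiated
   as finite sums. *)
have [N HN] := cvg_pinfty_ge z lamy.
pose S p x := \sum_(k < N) posR_pow p (x - lam k).
have RS p x : 0 < p -> x <= z -> riesz_mean lam p x = S p x.
  by move=> p0 xz; apply: riesz_meanE => // k /HN; exact: le_trans.
rewrite !RS//; set p := r / c.
pose df x := r * S (r - 1) x * x `^ (- p) - S r x * p * x `^ (- p - 1).
suff : S r y * y `^ (- p) <= S r z * z `^ (- p) by rewrite !powRN.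
apply: (@ge0_derive_le _ (fun x => S r x * x `^ (- p)) df) => //.
  move=> x /andP[yx xz]; have x0 : 0 < x by rewrite (lt_le_trans y0).
  have ? := is_derive1_powR (- p) x0.
  have ? := is_derive_riesz_sum lam N x r1.
  by apply: is_derive_eq; rewrite /df /S /GRing.scale/=; ring.
move=> x /andP[yx xz]; have x0 : 0 < x by rewrite (lt_trans y0).
have xE : x `^ (- p) = x * x `^ (- p - 1).
  by rewrite powRB ?powRr1 ?(gt_eqF x0) ?implybT ?(ltW x0)// mulrC divfK ?gt_eqF.
rewrite /df xE subr_ge0 mulrA ler_wpM2r ?powR_ge0//.
have := H x (ltW x0); rewrite !RS ?(ltW xz)// => Hx.
rewrite -(ler_pM2l c0) (_ : c * (S r x * p) = r * S r x); last first.
  by rewrite /p; field; rewrite gt_eqF.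
by rewrite -(ler_pM2l r0) in Hx; lra.
Qed.

(** The step from sum rules to Riesz means for arbitrary symmetric nonnegative weights:
    antisymmetrize the first rule, bound each term by [posR_pow_antisym], then apply the second
    rule. *)
Lemma riesz_sum_le lam (w : nat -> nat -> R) (T : nat -> R) r (C s : R) z n :
  1 < r -> 1 <= C ->
  (forall x y : R, 0 <= y -> y <= x -> x `^ r - y `^ r <=
     C * (x `^ (r - 1) + y `^ (r - 1)) * (x - y)) ->
  (forall j k, 0 <= w j k) -> (forall j k, w j k = w k j) ->
  (forall j, \sum_(k < m) (lam k - lam j) * w j k @[m --> \oo] --> s) ->
  (forall j m, \sum_(k < m) (lam k - lam j) ^+ 2 * w j k <= T j) ->
  (forall k, (n <= k)%N -> z <= lam k) ->
  s * \sum_(j < n) posR_pow r (z - lam j) <=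
  C * \sum_(j < n) posR_pow (r - 1) (z - lam j) * T j.
Proof.
move=> r1 C1 HC w0 wC S1 S2 zlam.
have r0 : 0 < r by lra. have r10 : 0 < r - 1 by lra. have C0 : 0 <= C by lra.
set f := fun j => posR_pow r (z - lam j).
set g := fun j => posR_pow (r - 1) (z - lam j).
have f0 j : (n <= j)%N -> f j = 0.
  by move=> /zlam nj; apply: posR_pow0 => //; rewrite subr_le0.
have g0 j : (n <= j)%N -> g j = 0.
  by move=> /zlam nj; apply: posR_pow0 => //; rewrite subr_le0.
have trunc (h : nat -> R) m : (n <= m)%N -> (forall j, (n <= j)%N -> h j = 0) ->
    \sum_(j < m) h j = \sum_(j < n) h j.
  move=> nm h0; rewrite -(subnKC nm) big_split_ord/= [X in _ + X]big1 ?addr0//.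
  by move=> i _; rewrite h0// leq_addr.
(* Only finitely many [f j] are nonzero, so the first rule can be summed over [j] inside the
   limit. *)
have cv : \sum_(j < n) f j * \sum_(k < m) (lam k - lam j) * w j k
    @[m --> \oo] --> s * \sum_(j < n) f j.
  rewrite mulrC mulr_suml.
  apply: cvg_big => [|j _]; first exact: add_continuous.
  apply: cvgM; [exact: cvg_cst|exact: S1].
(* From here on both indices run below the same [m >= n]. The finite square allows [j] and [k] to be
   exchanged without any question of convergence. *)
apply: (cvgr_to_le cv); near=> m.
 have nm : (n <= m)%N by near: m; exists n.
rewrite -[leLHS](trunc (fun j => f j * \sum_(k < m) (lam k - lam j) * w j k) m)//=;
  last by move=> j /f0 ->; rewrite mul0r.
rewrite -[X in C * X](trunc (fun j => g j * T j) m)//=;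
  last by move=> j /g0 ->; rewrite mul0r.
(* The second rule bounds every partial sum, in particular the one cut at [m]. *)
apply: (@le_trans _ _ (C * \sum_(j < m) g j *
    \sum_(k < m) (lam k - lam j) ^+ 2 * w j k)); last first.
  rewrite ler_wpM2l//; apply: ler_sum => j _; rewrite ler_wpM2l//.
  exact: posR_pow_ge0.
(* Averaging with the exchanged sum: [lam k - lam j] changes sign and [w] does not, so [f j] becomes
   [(f j - f k) / 2]. In the next identity the square keeps its sign and [g j] becomes
   [(g j + g k) / 2]. *)
have -> : \sum_(j < m) f j * \sum_(k < m) (lam k - lam j) * w j k =
    2^-1 * \sum_(j < m) \sum_(k < m) (f j - f k) * (lam k - lam j) * w j k.
  have E : \sum_(j < m) f j * \sum_(k < m) (lam k - lam j) * w j k =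
      \sum_(j < m) \sum_(k < m) f j * (lam k - lam j) * w j k.
    by apply: eq_bigr => j _; rewrite mulr_sumr; apply: eq_bigr => k _; ring.
  rewrite E; set X := LHS; suff -> : \sum_(j < m) \sum_(k < m)
      (f j - f k) * (lam k - lam j) * w j k = X + X by lra.
  rewrite {2}/X [X in _ = _ + X]exchange_big -big_split; apply: eq_bigr => j _.
  rewrite -big_split; apply: eq_bigr => k _ /=.
  by rewrite (wC k j); ring.
have -> : \sum_(j < m) g j * \sum_(k < m) (lam k - lam j) ^+ 2 * w j k =
    2^-1 * \sum_(j < m) \sum_(k < m)
      (g j + g k) * (lam k - lam j) ^+ 2 * w j k.
  have E : \sum_(j < m) g j * \sum_(k < m) (lam k - lam j) ^+ 2 * w j k =
      \sum_(j < m) \sum_(k < m) g j * (lam k - lam j) ^+ 2 * w j k.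
    by apply: eq_bigr => j _; rewrite mulr_sumr; apply: eq_bigr => k _; ring.
  rewrite E; set X := LHS; suff -> : \sum_(j < m) \sum_(k < m)
      (g j + g k) * (lam k - lam j) ^+ 2 * w j k = X + X by lra.
  rewrite {2}/X [X in _ = _ + X]exchange_big -big_split; apply: eq_bigr => j _.
  rewrite -big_split; apply: eq_bigr => k _ /=.
  by rewrite (wC k j); ring.
rewrite mulrCA ler_pM2l ?invr_gt0// mulr_sumr; apply: ler_sum => j _.
rewrite mulr_sumr; apply: ler_sum => k _; rewrite !mulrA ler_wpM2r//.
have := @posR_pow_antisym R r C (z - lam j) (z - lam k) r1 C1 HC.
by rewrite (_ : z - lam j - (z - lam k) = lam k - lam j) ?expr2 ?mulrA; last ring.
Unshelve. all: by end_near. Qed.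
End RieszMeans.

(** * The Hilbert space of square-integrable functions *)

Section MeasurableRVTopology.
Variables (R : realType) (d : nat).

(* An open set is the union of the boxes with rational centre and radius
   1 / (n + 1) that it contains. *)
Lemma open_measurable_rV (A : set 'rV[R]_d) : open A -> measurable A.
Proof.
move=> oA.
pose B (p : 'rV[rat]_d * nat) : set 'rV[R]_d :=
  [set v | forall i, `|v ord0 i - ratr (p.1 ord0 i)| < p.2.+1%:R^-1].
have mB p : measurable (B p).
  rewrite (_ : B p = \bigcap_(i in [set: 'I_d])
      ((fun v : 'rV[R]_d => v ord0 i : R) @^-1`
        (ball (ratr (p.1 ord0 i) : R) p.2.+1%:R^-1))).
    apply: fin_bigcap_measurable => // i _.
    rewrite -[X in measurable X]setTI.
    by apply: (measurable_coord i measurableT); by rewrite ball_itv; exact: measurable_itv.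
  by apply/seteqP; split => v /= H i => [_|]; have := H i;
    rewrite /ball/= distrC // => /(_ I).
rewrite (_ : A = \bigcup_(p in [set p | B p `<=` A]) B p).
  rewrite bigcup_mkcond; apply: countable_bigcupT_measurable => // p.
  by case: ifP => _; [exact: mB|exact: measurable0].
apply/seteqP; split => [v Av|v [p /= pA]]; last exact: pA.
have /nbhs_ballP[e /= e0 eA] : nbhs v A by exact: open_nbhs_nbhs.
have [n ne] : exists n : nat, n.+1%:R^-1 < e / 2.
  have [n _ /(_ n (leqnn _))] := near_infty_natSinv_lt (PosNum (divr_gt0 e0 (ltr0Sn R 1))).
  by exists n.
have /choice[q Hq] : forall i, exists q : rat, `|v ord0 i - ratr q| < n.+1%:R^-1.
  move=> i; have : v ord0 i - n.+1%:R^-1 < v ord0 i + n.+1%:R^-1.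
    by rewrite ltrD2l gtrN// invr_gt0.
  move=> /rat_in_itvoo[q]; rewrite in_itv/= => /andP[q1 q2].
  by exists q; rewrite distrC ltr_distl q1.
exists (\row_i q i, n) => /=; last by move=> i /=; rewrite mxE.
move=> w Bw; apply: eA; split => // i j; rewrite (ord1 i).
rewrite /ball/= -(subrKA (ratr (q j))) (splitr e) (le_lt_trans (ler_normD _ _))//.
rewrite ltrD ?(lt_trans (Hq j))// distrC.
by have := Bw j; rewrite /= mxE => /lt_trans; exact.
Qed.
End MeasurableRVTopology.

(** * Real and imaginary parts and the squared modulus *)

Section ComplexParts.
Variable R : realType.
Local Notation C := R[i].
Implicit Types z w : C.

Lemma ReD z w : complex.Re (z + w) = complex.Re z + complex.Re w.
Proof. by case: z w => a b [c e]. Qed.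
Lemma ImD z w : complex.Im (z + w) = complex.Im z + complex.Im w.
Proof. by case: z w => a b [c e]. Qed.
Lemma ReM z w : complex.Re (z * w) =
  complex.Re z * complex.Re w - complex.Im z * complex.Im w.
Proof. by case: z w => a b [c e]. Qed.
Lemma ImM z w : complex.Im (z * w) =
  complex.Re z * complex.Im w + complex.Im z * complex.Re w.
Proof. by case: z w => a b [c e]. Qed.
Lemma ReN z : complex.Re (- z) = - complex.Re z.
Proof. by case: z. Qed.
Lemma ImN z : complex.Im (- z) = - complex.Im z.
Proof. by case: z. Qed.
Lemma Re_conj z : complex.Re (conjc z) = complex.Re z.
Proof. by case: z. Qed.
Lemma Im_conj z : complex.Im (conjc z) = - complex.Im z.
Proof. by case: z. Qed.

Definition partsE := (ReD, ImD, ReM, ImM, ReN, ImN, Re_conj, Im_conj).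

Lemma complex_eq z w : complex.Re z = complex.Re w ->
  complex.Im z = complex.Im w -> z = w.
Proof. by case: z w => a b [c e] /= -> ->. Qed.

Lemma sqmod_ge0 z : 0 <= sqmod z.
Proof. by rewrite addr_ge0 ?sqr_ge0. Qed.

Lemma sqmodM z w : sqmod (z * w) = sqmod z * sqmod w.
Proof. rewrite /sqmod !partsE; ring. Qed.

Lemma sqmodD_le z w : sqmod (z + w) <= 2 * (sqmod z + sqmod w).
Proof.
rewrite /sqmod !partsE.
have := sqr_ge0 (complex.Re z - complex.Re w).
have := sqr_ge0 (complex.Im z - complex.Im w).
lra.
Qed.

Lemma sqmod_conj z : sqmod (conjc z) = sqmod z.
Proof. by rewrite /sqmod !partsE sqrrN. Qed.

Lemma sqmod0 : sqmod (0 : C) = 0.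
Proof. by rewrite /sqmod expr0n addr0. Qed.

(** Weighted Young inequality. The free weight [s] lets it do the work of the Cauchy-Schwarz
    inequality after integration. *)
Lemma Re_mul_conj_le z w (s : R) : 0 < s ->
  `|complex.Re (z * conjc w)| <= (s * sqmod z + s^-1 * sqmod w) / 2.
Proof.
move=> s0; rewrite /sqmod !partsE.
set a := complex.Re z; set b := complex.Im z.
set c := complex.Re w; set e := complex.Im w.
have [s' ss'] : exists s', s * s' = 1 by exists s^-1; rewrite mulfV ?gt_eqF.
have -> : s^-1 = s' by apply: (mulfI (lt0r_neq0 s0)); rewrite ss' mulfV ?gt_eqF.
have s'0 : 0 <= s' by rewrite -(pmulr_rge0 _ s0) ss'.
(* The values [t = 1] and [t = -1] give the two halves of the absolute value; the gap is a
   nonnegative multiple of a sum of squares. *)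
have P (t : R) : t ^+ 2 = 1 ->
  t * (a * c - b * - e) <= (s * (a ^+ 2 + b ^+ 2) + s' * (c ^+ 2 + e ^+ 2)) / 2.
  move=> t1; rewrite -subr_ge0.
  rewrite (_ : _ - _ = s' / 2 * ((s * a - t * c) ^+ 2 + (s * b - t * e) ^+ 2)).
    by rewrite mulr_ge0 ?addr_ge0 ?sqr_ge0 ?divr_ge0.
  have -> : s' / 2 * ((s * a - t * c) ^+ 2 + (s * b - t * e) ^+ 2) =
    ((s * s') * (s * (a ^+ 2 + b ^+ 2)) + s' * (t ^+ 2 * (c ^+ 2 + e ^+ 2))) / 2
    - (s * s') * t * (a * c - b * - e) by field.
  by rewrite ss' t1; ring.
rewrite ler_norml.
have := P 1 (expr1n _ _); have := P (- 1); rewrite sqrrN expr1n => /(_ erefl).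
lra.
Qed.
End ComplexParts.

(** * Square-integrable functions and their inner product *)

Section L2.
Variables (R : realType) (d : nat) (Om : set 'rV[R]_d).
Hypothesis mOm : measurable Om.
Local Notation E := 'rV[R]_d.
Local Notation C := R[i].
Local Notation mu := (lebesgue_rV R d).
Local Notation L2 := (in_L2 Om).
Local Notation "<< f , g >>" := (inner Om f g).
Implicit Types (f g h : E -> C) (z : C).

Lemma cmeasurableD f g : cmeasurable Om f -> cmeasurable Om g ->
  cmeasurable Om (fun x => f x + g x).
Proof.
move=> [f1 f2] [g1 g2]; split.
  by under eq_fun do rewrite ReD; exact: measurable_funD.
by under eq_fun do rewrite ImD; exact: measurable_funD.
Qed.

Lemma cmeasurableM f g : cmeasurable Om f -> cmeasurable Om g ->
  cmeasurable Om (fun x => f x * g x).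
Proof.
move=> [f1 f2] [g1 g2]; split.
  by under eq_fun do rewrite ReM; apply: measurable_funB; exact: measurable_funM.
by under eq_fun do rewrite ImM; apply: measurable_funD; exact: measurable_funM.
Qed.

Lemma cmeasurable_conj f : cmeasurable Om f ->
  cmeasurable Om (fun x => conjc (f x)).
Proof.
move=> [f1 f2]; split.
  by under eq_fun do rewrite Re_conj.
by under eq_fun do rewrite Im_conj; exact: measurable_funN.
Qed.

Lemma cmeasurable_cst z : cmeasurable Om (fun=> z).
Proof. by split; exact: measurable_cst. Qed.

Lemma measurable_sqmod f : cmeasurable Om f ->
  measurable_fun Om (fun x => sqmod (f x)).
Proof. by move=> [f1 f2]; apply: measurable_funD; exact: measurable_funX. Qed.

Lemma in_L2P f : L2 f <->
  cmeasurable Om f /\ mu.-integrable Om (EFin \o (fun x => sqmod (f x))).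
Proof.
split=> -[mf H]; split => //.
  apply/integrableP; split.
    by apply/measurable_EFinP; exact: measurable_sqmod.
  by under eq_integral do rewrite /= ger0_norm ?sqmod_ge0//.
have /integrableP[_] := H.
by under eq_integral do rewrite /= ger0_norm ?sqmod_ge0//.
Qed.

Lemma in_L2_dominated f g (c : R) : cmeasurable Om f -> L2 g ->
  (forall x, sqmod (f x) <= c * sqmod (g x)) -> L2 f.
Proof.
move=> mf /in_L2P[mg ig] fg; apply/in_L2P; split => //.
apply: (le_integrable mOm _ _ (integrableZl mOm c ig)) => /=.
  by apply/measurable_EFinP; exact: measurable_sqmod.
move=> x Omx; rewrite lee_fin ger0_norm ?sqmod_ge0// (le_trans (fg x))//.
exact: ler_norm.
Qed.

Lemma in_L2D f g : L2 f -> L2 g -> L2 (fun x => f x + g x).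
Proof.
move=> /in_L2P[mf fi] /in_L2P[mg gi]; apply/in_L2P.
have mfg := cmeasurableD mf mg; split => //.
apply: (le_integrable mOm _ _ (integrableZl mOm 2 (integrableD mOm fi gi))) => /=.
  by apply/measurable_EFinP; exact: measurable_sqmod.
move=> x Omx; rewrite lee_fin ger0_norm ?sqmod_ge0// (le_trans (sqmodD_le _ _))//.
exact: ler_norm.
Qed.

Lemma in_L2Z z f : L2 f -> L2 (fun x => z * f x).
Proof.
move=> L2f; have [mf _] := L2f; apply: (in_L2_dominated (c := sqmod z) _ L2f).
  exact: (cmeasurableM (cmeasurable_cst z)).
by move=> x; rewrite sqmodM.
Qed.

Lemma in_L2B f g : L2 f -> L2 g -> L2 (fun x => f x - g x).
Proof.
move=> L2f L2g; have := in_L2D L2f (in_L2Z (- 1) L2g).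
by under eq_fun do rewrite mulN1r.
Qed.

Lemma in_L2_cst0 : L2 (fun=> 0).
Proof.
split; first exact: cmeasurable_cst.
by rewrite /sqnorm; under eq_integral do rewrite sqmod0; rewrite integral0.
Qed.

Lemma in_L2_sum n (c : nat -> C) (u : nat -> E -> C) : (forall k, L2 (u k)) ->
  L2 (fun x => \sum_(k < n) c k * u k x).
Proof.
move=> L2u; elim: n => [|n IH].
  by under eq_fun do rewrite big_ord0; exact: in_L2_cst0.
under eq_fun do rewrite big_ord_recr/=.
by apply: in_L2D => //; exact: in_L2Z.
Qed.

Lemma integrable_Re_inner f g : L2 f -> L2 g ->
  mu.-integrable Om (EFin \o (fun x => complex.Re (f x * conjc (g x)))).
Proof.
move=> /in_L2P[mf fi] /in_L2P[mg gi].
apply: (le_integrable mOm _ _ (integrableD mOm fi gi)) => /=.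
  apply/measurable_EFinP.
  by have [] := cmeasurableM mf (cmeasurable_conj mg).
move=> x Omx; rewrite lee_fin (le_trans (Re_mul_conj_le _ _ ltr01))//.
rewrite invr1 !mul1r [leRHS]ger0_norm; last exact: addr_ge0 (sqmod_ge0 _) (sqmod_ge0 _).
have := sqmod_ge0 (f x); have := sqmod_ge0 (g x); lra.
Qed.

(** The imaginary part of a number is the real part of its product with [-i]. *)
Lemma integrable_Im_inner f g : L2 f -> L2 g ->
  mu.-integrable Om (EFin \o (fun x => complex.Im (f x * conjc (g x)))).
Proof.
move=> L2f L2g; have := integrable_Re_inner (in_L2Z (Complex 0 (- 1)) L2f) L2g.
congr (is_true (integrable _ _ (EFin \o _))); apply/funext => x.
by rewrite !partsE/=; ring.
Qed.

Lemma inner_conj f g : L2 f -> L2 g -> << g, f >> = conjc << f, g >>.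
Proof.
move=> L2f L2g; rewrite /inner /cintegral; apply: complex_eq; rewrite !partsE/=.
  by apply: eq_Rintegral => x _; rewrite !partsE; ring.
rewrite -mulN1r -RintegralZl//; last exact: integrable_Im_inner.
by apply: eq_Rintegral => x _; rewrite !partsE; ring.
Qed.

Lemma innerDl f g h : L2 f -> L2 g -> L2 h ->
  << fun x => f x + g x, h >> = << f, h >> + << g, h >>.
Proof.
move=> L2f L2g L2h; rewrite /inner /cintegral; apply: complex_eq.
  rewrite ReD/= -RintegralD//; try exact: integrable_Re_inner.
  by apply: eq_Rintegral => x _; rewrite !partsE; ring.
rewrite ImD/= -RintegralD//; try exact: integrable_Im_inner.
by apply: eq_Rintegral => x _; rewrite !partsE; ring.
Qed.

Lemma innerZl z f g : L2 f -> L2 g -> << fun x => z * f x, g >> = z * << f, g >>.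
Proof.
move=> L2f L2g.
have iR := integrable_Re_inner L2f L2g; have iI := integrable_Im_inner L2f L2g.
have sZ (a : R) k : mu.-integrable Om (EFin \o k) ->
    mu.-integrable Om (EFin \o (fun x => a * k x)).
  by move=> /(integrableZl mOm a).
rewrite /inner /cintegral; apply: complex_eq.
  rewrite ReM/= -!RintegralZl// -RintegralB//; try exact: sZ.
  by apply: eq_Rintegral => x _; rewrite !partsE; ring.
rewrite ImM/= -!RintegralZl// -RintegralD//; try exact: sZ.
by apply: eq_Rintegral => x _; rewrite !partsE; ring.
Qed.

Lemma innerDr f g h : L2 f -> L2 g -> L2 h ->
  << h, fun x => f x + g x >> = << h, f >> + << h, g >>.
Proof.
move=> L2f L2g L2h; rewrite inner_conj//; last exact: in_L2D.
rewrite innerDl// (inner_conj L2h L2f) (inner_conj L2h L2g).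
by apply: complex_eq; rewrite !partsE; ring.
Qed.

Lemma innerZr z f g : L2 f -> L2 g ->
  << f, fun x => z * g x >> = conjc z * << f, g >>.
Proof.
move=> L2f L2g; rewrite inner_conj//; last exact: in_L2Z.
rewrite innerZl// (inner_conj L2f L2g).
by apply: complex_eq; rewrite !partsE; ring.
Qed.

Lemma innerBl f g h : L2 f -> L2 g -> L2 h ->
  << fun x => f x - g x, h >> = << f, h >> - << g, h >>.
Proof.
move=> L2f L2g L2h; have L2Ng := in_L2Z (- 1) L2g.
rewrite -mulN1r -innerZl// -innerDl//; congr inner.
by apply/funext => x; rewrite mulN1r.
Qed.

(** The real-valued counterpart of [sqnorm]; the two agree on square-integrable functions by
    [sqnormE]. *)
Definition normsq f : R := complex.Re << f, f >>.

Lemma Re_mul_conj f x : complex.Re (f x * conjc (f x)) = sqmod (f x).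
Proof. by rewrite /sqmod !partsE; ring. Qed.

Lemma normsqE f : normsq f = \int[mu]_(x in Om) sqmod (f x).
Proof. by apply: eq_Rintegral => x _; exact: Re_mul_conj. Qed.

Lemma sqnormE f : L2 f -> sqnorm Om f = (normsq f)%:E.
Proof.
move=> /in_L2P[_ fi]; rewrite normsqE /Rintegral fineK//.
exact: integrable_fin_num.
Qed.

Lemma normsq_ge0 f : 0 <= normsq f.
Proof. by rewrite normsqE; apply: Rintegral_ge0 => x _; exact: sqmod_ge0. Qed.

Lemma inner_self f : L2 f -> << f, f >> = Complex (normsq f) 0.
Proof.
move=> L2f; apply: complex_eq => //=.
have := congr1 (@complex.Im R) (inner_conj L2f L2f); rewrite Im_conj /inner/=.
set a := Rintegral _ _ _; lra.
Qed.

Lemma Re_inner_le f g (s : R) : L2 f -> L2 g -> 0 < s ->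
  `|complex.Re << f, g >>| <= (s * normsq f + s^-1 * normsq g) / 2.
Proof.
move=> L2f L2g s0; have /in_L2P[_ fi] := L2f; have /in_L2P[_ gi] := L2g.
have iR := integrable_Re_inner L2f L2g.
have fi' := integrableZl mOm (s / 2) fi.
have gi' := integrableZl mOm (s^-1 / 2) gi.
apply: (le_trans (le_normr_Rintegral mOm iR)).
have -> : (s * normsq f + s^-1 * normsq g) / 2 = \int[mu]_(x in Om)
    (s / 2 * sqmod (f x) + s^-1 / 2 * sqmod (g x)).
  by rewrite RintegralD// !RintegralZl// !normsqE; lra.
apply: le_Rintegral => //; first exact: integrable_norm.
  exact: (integrableD mOm fi' gi').
move=> x _; apply: le_trans (Re_mul_conj_le (f x) (g x) s0) _.
by rewrite mulrDl ![_ * _ / 2]mulrAC.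
Qed.

End L2.

(** * Bessel's inequality and Parseval's identity *)

Section Parseval.
Variables (R : realType) (d : nat) (Om : set 'rV[R]_d).
Hypothesis mOm : measurable Om.
Local Notation E := 'rV[R]_d.
Local Notation C := R[i].
Local Notation L2 := (in_L2 Om).
Local Notation "<< f , g >>" := (inner Om f g).
Local Notation N := (normsq Om).
Variable u : nat -> E -> C.
Hypothesis on : orthonormal_family Om u.
Implicit Types (f g : E -> C) (c : nat -> C) (z : C).

Lemma normsqD f g : L2 f -> L2 g ->
  N (fun x => f x + g x) = N f + N g + 2 * complex.Re << f, g >>.
Proof.
move=> L2f L2g; rewrite /normsq innerDl ?innerDr//; last exact: in_L2D.
by rewrite (inner_conj mOm L2f L2g) !partsE; ring.
Qed.

Lemma normsqZ z f : L2 f -> N (fun x => z * f x) = sqmod z * N f.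
Proof.
move=> L2f; have L2zf := in_L2Z mOm z L2f.
rewrite /normsq innerZl// innerZr// (inner_self mOm L2f).
by rewrite /sqmod !partsE/=; ring.
Qed.

Lemma normsq_basis k : N (u k) = 1.
Proof. by rewrite /normsq on.2 eqxx. Qed.

Lemma inner_lincomb_basis n c m : (n <= m)%N ->
  << fun x => \sum_(k < n) c k * u k x, u m >> = 0.
Proof.
have [L2u onu] := on.
elim: n => [|n IH] nm.
  under [X in inner _ X _]eq_fun do rewrite big_ord0 -[0](mul0r 0).
  by rewrite innerZl ?mul0r//; exact: in_L2_cst0.
under [X in inner _ X _]eq_fun do rewrite big_ord_recr/=.
have := in_L2_sum mOm n c L2u; have := in_L2Z mOm (c n) (L2u n) => h1 h2.
by rewrite innerDl// IH 1?ltnW// innerZl// onu ltn_eqF// mulr0 addr0.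
Qed.

(** Completing the square, one basis vector at a time. The last sum vanishes for the Fourier
    coefficients, which gives Bessel, and is nonnegative for any others, which gives Parseval from
    density. *)
Lemma normsq_sub_lincomb f c n : L2 f ->
  N (fun x => f x - \sum_(k < n) c k * u k x) =
  N f - \sum_(k < n) sqmod << f, u k >> +
        \sum_(k < n) sqmod (c k - << f, u k >>).
Proof.
have [L2u onu] := on.
move=> L2f; elim: n => [|n IH].
  rewrite !big_ord0 subr0 addr0; congr N; apply/funext => x.
  by rewrite big_ord0 subr0.
have L2s := in_L2_sum mOm n c L2u; have L2fs := in_L2B mOm L2f L2s.
have L2un := in_L2Z mOm (- c n) (L2u n).
under [X in N X]eq_fun do rewrite big_ord_recr/= opprD addrA -mulNr.
rewrite normsqD// IH normsqZ// normsq_basis innerZr// innerBl//.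
rewrite inner_lincomb_basis// !big_ord_recr/= /sqmod !partsE/=; ring.
Qed.

Lemma bessel f n : L2 f -> \sum_(k < n) sqmod << f, u k >> <= N f.
Proof.
move=> L2f; have := normsq_sub_lincomb (fun k => << f, u k >>) n L2f.
rewrite [X in _ = _ + X]big1 ?addr0 => [H|k _]; last by rewrite subrr sqmod0.
by rewrite -subr_ge0 -H normsq_ge0.
Qed.

Hypothesis cpl : complete_family Om u.

Lemma parseval f : L2 f ->
  \sum_(k < n) sqmod << f, u k >> @[n --> \oo] --> N f.
Proof.
move=> L2f; have [L2u onu] := on; apply/cvgrPdist_lt => e e0.
have [n [c]] := cpl L2f e0.
rewrite sqnormE//; last by apply: in_L2B => //; exact: in_L2_sum.
rewrite lte_fin normsq_sub_lincomb// => H.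
(* Dropping the last sum replaces the approximating coefficients by the Fourier coefficients. *)
have {}H : N f - \sum_(k < n) sqmod << f, u k >> < e.
  by apply: le_lt_trans H; rewrite lerDl sumr_ge0// => k _; exact: sqmod_ge0.
exists n => // m /= nm; rewrite ger0_norm ?subr_ge0 ?bessel//.
apply: le_lt_trans H; rewrite lerD2l lerN2 -(subnKC nm) big_split_ord/=.
by rewrite lerDl sumr_ge0// => k _; exact: sqmod_ge0.
Qed.

(* Polarization, with the real parts only. *)
Lemma parseval_inner f g : L2 f -> L2 g ->
  \sum_(k < n) complex.Re (<< f, u k >> * conjc << g, u k >>)
    @[n --> \oo] --> complex.Re << f, g >>.
Proof.
move=> L2f L2g; have [L2u onu] := on.
have E n : \sum_(k < n) complex.Re (<< f, u k >> * conjc << g, u k >>) =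
    2^-1 * (\sum_(k < n) sqmod << fun x => f x + g x, u k >> -
      \sum_(k < n) sqmod << f, u k >> - \sum_(k < n) sqmod << g, u k >>).
  rewrite -!sumrB mulr_sumr; apply: eq_bigr => k _.
  rewrite innerDl//; move: << f, u k >> << g, u k >> => a b.
  by rewrite /sqmod !partsE; field.
under eq_fun do rewrite E.
rewrite (_ : complex.Re _ = 2^-1 * (N (fun x => f x + g x) - N f - N g)); last first.
  by rewrite normsqD//; field.
have L2fg := in_L2D mOm L2f L2g.
apply: cvgM; first exact: cvg_cst.
by apply: cvgB; [apply: cvgB|]; exact: parseval.
Qed.

End Parseval.

(** * Plane waves and test functions *)

Section PlaneWaves.
Variables (R : realType) (d : nat).
Local Notation E := 'rV[R]_d.
Local Notation C := R[i].
Implicit Types (f g phi : E -> C) (z : C) (t : R) (i j : 'I_d).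

Definition plane_wave t i : E -> C :=
  fun x => Complex (cos (t * x ord0 i)) (sin (t * x ord0 i)).

Lemma sqmod_plane_wave t i x : sqmod (plane_wave t i x) = 1.
Proof. exact: cos2Dsin2. Qed.

Lemma conj_plane_wave t i x : conjc (plane_wave t i x) = plane_wave (- t) i x.
Proof. by rewrite /plane_wave mulNr cosN sinN. Qed.

Lemma plane_waveK t i x : plane_wave t i x * plane_wave (- t) i x = 1.
Proof.
rewrite -conj_plane_wave; apply: complex_eq; rewrite !partsE/=; last by ring.
by rewrite -(cos2Dsin2 (t * x ord0 i)); ring.
Qed.

Lemma plane_wave_neq0 t i x : plane_wave t i x != 0.
Proof.
apply/eqP => e0; have := plane_waveK t i x; rewrite e0 mul0r => /esym/eqP.
by rewrite oner_eq0.
Qed.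

Lemma cmeasurable_plane_wave (Om : set E) t i :
  cmeasurable Om (plane_wave t i).
Proof.
have mt : measurable_fun Om (fun x : E => t * x ord0 i).
  apply: measurable_funM; first exact: measurable_cst.
  by apply: measurable_funTS; exact: measurable_coord.
split=> /=.
- apply: (measurableT_comp (f := @cos R)) => //.
  by apply: continuous_measurable_fun; exact: continuous_cos.
- apply: (measurableT_comp (f := @sin R)) => //.
  by apply: continuous_measurable_fun; exact: continuous_sin.
Qed.

Definition cdifferentiable f (x : E) : Prop :=
  differentiable (fun y => complex.Re (f y) : R^o) x /\
  differentiable (fun y => complex.Im (f y) : R^o) x.

Lemma cdifferentiableD f g x : cdifferentiable f x -> cdifferentiable g x ->
  cdifferentiable (fun y => f y + g y) x.
Proof.
move=> [f1 f2] [g1 g2]; split.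
  by under eq_fun do rewrite ReD; exact: differentiableD.
by under eq_fun do rewrite ImD; exact: differentiableD.
Qed.

Lemma cdifferentiableM f g x : cdifferentiable f x -> cdifferentiable g x ->
  cdifferentiable (fun y => f y * g y) x.
Proof.
move=> [f1 f2] [g1 g2]; split.
  under eq_fun do rewrite ReM.
  by apply: differentiableB; exact: differentiableM.
under eq_fun do rewrite ImM.
by apply: differentiableD; exact: differentiableM.
Qed.

Lemma cdifferentiable_cst z x : cdifferentiable (fun=> z) x.
Proof. by split; exact: differentiable_cst. Qed.

Lemma cdifferentiable_conj f x : cdifferentiable f x ->
  cdifferentiable (fun y => conjc (f y)) x.
Proof.
move=> [f1 f2]; split.
  by under eq_fun do rewrite Re_conj.
by under eq_fun do rewrite Im_conj; exact: differentiableN.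
Qed.

Lemma differentiable_scaled_coord t i (x : E) :
  differentiable (fun y : E => t * y ord0 i : R^o) x.
Proof.
apply: differentiableM; first exact: differentiable_cst.
exact: differentiable_coord.
Qed.

Lemma derive_scaled_coord t i (x v : E) :
  'D_v (fun y : E => t * y ord0 i : R^o) x = t * v ord0 i.
Proof.
apply: cvg_lim => //; apply: cvg_near_cst; near=> h => /=.
have h0 : h != 0 by near: h; exact: nbhs_dnbhs_neq.
by rewrite !mxE /GRing.scale/=; field.
Unshelve. all: by end_near. Qed.

Lemma cdifferentiable_plane_wave t i x : cdifferentiable (plane_wave t i) x.
Proof.
have dt := differentiable_scaled_coord t i x.
split => /=.
  apply: (differentiable_comp (g := @cos R) dt).
  by apply/derivable1_diffP; exact: ex_derive.
apply: (differentiable_comp (g := @sin R) dt).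
by apply/derivable1_diffP; exact: ex_derive.
Qed.

Lemma Re_partial_deriv i f x : complex.Re (partial_deriv i f x) =
  'D_(delta_mx ord0 i : E) (fun y => complex.Re (f y) : R^o) x.
Proof. by []. Qed.

Lemma Im_partial_deriv i f x : complex.Im (partial_deriv i f x) =
  'D_(delta_mx ord0 i : E) (fun y => complex.Im (f y) : R^o) x.
Proof. by []. Qed.

Lemma partial_derivD i f g x : cdifferentiable f x -> cdifferentiable g x ->
  partial_deriv i (fun y => f y + g y) x =
  partial_deriv i f x + partial_deriv i g x.
Proof.
move=> [f1 f2] [g1 g2]; apply: complex_eq; rewrite !partsE !(Re_partial_deriv, Im_partial_deriv).
  under eq_fun do rewrite ReD.
  by rewrite deriveD//; exact: diff_derivable.
under eq_fun do rewrite ImD.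
by rewrite deriveD//; exact: diff_derivable.
Qed.

Lemma partial_derivM i f g x : cdifferentiable f x -> cdifferentiable g x ->
  partial_deriv i (fun y => f y * g y) x =
  partial_deriv i f x * g x + f x * partial_deriv i g x.
Proof.
move=> [f1 f2] [g1 g2]; apply: complex_eq; rewrite !partsE !(Re_partial_deriv, Im_partial_deriv).
  under eq_fun do rewrite ReM.
  rewrite deriveB; [|exact/diff_derivable/differentiableM..].
  rewrite !deriveM; [|exact: diff_derivable..].
  by rewrite /GRing.scale/=; ring.
under eq_fun do rewrite ImM.
rewrite deriveD; [|exact/diff_derivable/differentiableM..].
rewrite !deriveM; [|exact: diff_derivable..].
by rewrite /GRing.scale/=; ring.
Qed.

Lemma partial_deriv_cst i z x : partial_deriv i (fun=> z) x = 0.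
Proof. by apply: complex_eq; exact: derive_cst. Qed.

Lemma partial_deriv_conj i f x : cdifferentiable f x ->
  partial_deriv i (fun y => conjc (f y)) x = conjc (partial_deriv i f x).
Proof.
move=> [f1 f2]; apply: complex_eq; rewrite !partsE !(Re_partial_deriv, Im_partial_deriv).
  by under eq_fun do rewrite Re_conj.
by under eq_fun do rewrite Im_conj; rewrite deriveN//; exact: diff_derivable.
Qed.

Lemma derive_comp_scaled_coord (h : R -> R) t i (x v : E) (dh : R) :
  is_derive (t * x ord0 i) 1 h dh ->
  'D_v (fun y : E => h (t * y ord0 i) : R^o) x = t * v ord0 i * dh.
Proof.
move=> [hd <-].
have dt := differentiable_scaled_coord t i x.
have dh' : differentiable h (t * x ord0 i) by exact/derivable1_diffP.
rewrite (deriveE _ (differentiable_comp (g := h) dt dh')).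
rewrite (diff_comp (g := h) dt dh')/= -(deriveE _ dt) derive_scaled_coord.
by rewrite diff1E// derive1E.
Qed.

(** The logarithmic derivative of the wave in direction [j]. *)
Definition wave_coef t i j : C := Complex 0 (t * (j == i)%:R).

Lemma partial_deriv_plane_wave t i j x :
  partial_deriv j (plane_wave t i) x = wave_coef t i j * plane_wave t i x.
Proof.
have de : (delta_mx ord0 j : E) ord0 i = (j == i)%:R by rewrite mxE eqxx eq_sym.
apply: complex_eq.
  rewrite Re_partial_deriv.
  rewrite [LHS](derive_comp_scaled_coord (h := @cos R) _ (is_derive_cos _)) de.
  by rewrite !partsE/=; ring.
rewrite Im_partial_deriv.
rewrite [LHS](derive_comp_scaled_coord (h := @sin R) _ (is_derive_sin _)) de.
by rewrite !partsE/=; ring.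
Qed.

Lemma smooth_cdifferentiable f x : smooth f -> cdifferentiable f x.
Proof. by move=> sf; exact: (sf [::] x). Qed.

Lemma smooth_partial_deriv f i : smooth f -> smooth (partial_deriv i f).
Proof. by move=> sf s; have := sf (rcons s i); rewrite foldr_rcons. Qed.

Lemma smoothD f g : smooth f -> smooth g -> smooth (fun x => f x + g x).
Proof.
move=> sf sg s.
suff -> : foldr (@partial_deriv R d) (fun x => f x + g x) s = fun x =>
    foldr (@partial_deriv R d) f s x + foldr (@partial_deriv R d) g s x.
  by move=> x; exact: cdifferentiableD.
elim: s => //= i s ->; apply/funext => x.
by rewrite partial_derivD.
Qed.

Lemma smoothZ z f : smooth f -> smooth (fun x => z * f x).
Proof.
move=> sf s.
suff -> : foldr (@partial_deriv R d) (fun x => z * f x) s = fun x =>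
    z * foldr (@partial_deriv R d) f s x.
  by move=> x; apply: cdifferentiableM => //; exact: cdifferentiable_cst.
elim: s => //= i s ->; apply/funext => x.
by rewrite partial_derivM ?partial_deriv_cst ?mul0r ?add0r//; exact: cdifferentiable_cst.
Qed.

Lemma smooth_conj f : smooth f -> smooth (fun x => conjc (f x)).
Proof.
move=> sf s.
suff -> : foldr (@partial_deriv R d) (fun x => conjc (f x)) s = fun x =>
    conjc (foldr (@partial_deriv R d) f s x).
  by move=> x; exact: cdifferentiable_conj.
elim: s => //= i s ->; apply/funext => x.
by rewrite partial_deriv_conj.
Qed.

Lemma partial_deriv_waveM t i j f x : cdifferentiable f x ->
  partial_deriv j (fun y => plane_wave t i y * f y) x =
  plane_wave t i x * (partial_deriv j f x + wave_coef t i j * f x).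
Proof.
move=> df; rewrite partial_derivM//; last exact: cdifferentiable_plane_wave.
by rewrite partial_deriv_plane_wave; ring.
Qed.

(** Every partial derivative of a wave times a smooth function is again the wave times a smooth
    function, so induction on the list of derivatives avoids a general Leibniz formula. *)
Lemma smooth_waveM t i f : smooth f -> smooth (fun x => plane_wave t i x * f x).
Proof.
move=> sf s.
suff [g sg ->] : exists2 g, smooth g & foldr (@partial_deriv R d)
    (fun x => plane_wave t i x * f x) s = fun x => plane_wave t i x * g x.
  move=> x; apply: cdifferentiableM; first exact: cdifferentiable_plane_wave.
  exact: smooth_cdifferentiable.
elim: s => [|j s [g sg /= ->]]; first by exists f.
exists (fun x => partial_deriv j g x + wave_coef t i j * g x).
  by apply: smoothD; [exact: smooth_partial_deriv|exact: smoothZ].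
apply/funext => x; rewrite partial_deriv_waveM//.
exact: smooth_cdifferentiable.
Qed.

(** Applied to multiplication by a wave and to conjugation, which preserve the zeros and hence the
    support. *)
Lemma test_function_eq_support Om phi psi : test_function Om phi ->
  smooth psi -> (forall x, (psi x == 0) = (phi x == 0)) -> test_function Om psi.
Proof.
move=> [_ cphi phiOm] spsi H.
have E : [set x | psi x != 0] = [set x | phi x != 0].
  by apply/funext => x; rewrite /= H.
by split => //; rewrite E.
Qed.

Lemma test_function_waveM Om t i phi : test_function Om phi ->
  test_function Om (fun x => plane_wave t i x * phi x).
Proof.
move=> tphi; have [sphi _ _] := tphi.
apply: (test_function_eq_support tphi); first exact: smooth_waveM.
by move=> x; rewrite mulf_eq0 (negbTE (plane_wave_neq0 t i x)).
Qed.

Lemma test_function_conj Om phi : test_function Om phi ->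
  test_function Om (fun x => conjc (phi x)).
Proof.
move=> tphi; have [sphi _ _] := tphi.
apply: (test_function_eq_support tphi); first exact: smooth_conj.
by move=> x; rewrite conjc_eq0.
Qed.

(** The wave varies in direction [i] only: there the Leibniz rule adds the cross term with [2 i t]
    and the second derivative [- t ^ 2] of the wave. *)
Lemma laplacian_waveM t i f x : smooth f ->
  laplacian (fun y => plane_wave t i y * f y) x = plane_wave t i x *
    (laplacian f x + 2 * Complex 0 t * partial_deriv i f x - Complex (t ^+ 2) 0 * f x).
Proof.
move=> sf; have df y := smooth_cdifferentiable y sf.
have ddf j y := smooth_cdifferentiable y (smooth_partial_deriv j sf).
have E j : partial_deriv j (partial_deriv j (fun y => plane_wave t i y * f y)) x =
    plane_wave t i x * partial_deriv j (partial_deriv j f) x +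
    (j == i)%:R * (plane_wave t i x *
      (2 * Complex 0 t * partial_deriv j f x - Complex (t ^+ 2) 0 * f x)).
  have -> : partial_deriv j (fun y => plane_wave t i y * f y) =
      fun y => plane_wave t i y * (partial_deriv j f y + wave_coef t i j * f y).
    by apply/funext => y; rewrite partial_deriv_waveM.
  have dc y : cdifferentiable (fun=> wave_coef t i j) y by exact: cdifferentiable_cst.
  rewrite partial_deriv_waveM; last first.
    by apply: cdifferentiableD => //; exact: cdifferentiableM.
  rewrite partial_derivD//; last exact: cdifferentiableM.
  rewrite partial_derivM// partial_deriv_cst mul0r add0r /wave_coef.
  case: (j == i); rewrite /= ?mulr1 ?mulr0.
    have -> : Complex (t ^+ 2) 0 = - (Complex 0 t * Complex 0 t) :> C.
      by apply: complex_eq; rewrite !partsE/=; ring.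
    by ring.
  have -> : Complex 0 0 = 0 :> C by [].
  by ring.
rewrite /laplacian (eq_bigr _ (fun j _ => E j)) big_split/= -mulr_sumr.
rewrite [X in _ + X](bigD1 i)//= eqxx [X in _ + (_ + X)]big1 ?addr0 => [|j /negbTE ->];
  last by rewrite mul0r.
by rewrite mul1r; ring.
Qed.

End PlaneWaves.

(** * The commutator of H with a plane wave *)

Section Commutator.
Variables (R : realType) (d : nat) (Om : set 'rV[R]_d).
Hypothesis mOm : measurable Om.
Local Notation E := 'rV[R]_d.
Local Notation C := R[i].
Local Notation L2 := (in_L2 Om).
Local Notation "<< f , g >>" := (inner Om f g).
Implicit Types (f g h F G v w phi : E -> C) (T : op_graph R d) (t : R).

(** The identity holds on [T] and both sides are continuous: with [(f, k)] in [T] close to [(w, h)],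
    only the pairings of [h - k] with [F] and of [w - f] with [G] remain. *)
Lemma Re_inner_op_closure T w h F G :
  (forall f k, T f k -> L2 f /\ L2 k) -> op_closure Om T w h -> L2 F -> L2 G ->
  (forall f k, T f k -> << k, F >> = << f, G >>) ->
  complex.Re << h, F >> = complex.Re << w, G >>.
Proof.
move=> TL2 [L2w L2h Twh] L2F L2G TFG; apply/eqP; rewrite -subr_eq0 -normr_le0.
apply/ler_addgt0Pr => e e0; rewrite add0r.
pose B := normsq Om F + normsq Om G.
have B0 : 0 <= B by rewrite addr_ge0 ?normsq_ge0.
(* The weight gives [B / s <= e], and the accuracy [e / (2 * s)] makes [s] times each approximation
   error at most [e / 2]. Half of the total is [e]. The [+ 1] keeps [s] positive when [B = 0]. *)
pose s := (B + 1) / e.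
have s0 : 0 < s by rewrite divr_gt0 ?ltr_wpDl.
have e2 : 0 < e / (2 * s) by rewrite divr_gt0// mulr_gt0.
have [f [k [Tfk wf hk]]] := Twh _ e2.
have [L2f L2k] := TL2 _ _ Tfk.
have L2wf := in_L2B mOm L2w L2f; have L2hk := in_L2B mOm L2h L2k.
move: wf hk; rewrite !sqnormE// !lte_fin => wf hk.
have -> : complex.Re << h, F >> - complex.Re << w, G >> =
    complex.Re << fun x => h x - k x, F >> - complex.Re << fun x => w x - f x, G >>.
  by rewrite !innerBl// (TFG _ _ Tfk) !partsE; ring.
apply: le_trans (ler_normB _ _) _.
have := Re_inner_le mOm L2wf L2G s0; have := Re_inner_le mOm L2hk L2F s0.
have sB : s^-1 * B <= e.
  rewrite /s invf_div mulrAC -mulrA ler_piMr ?(ltW e0)//.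
  by rewrite ler_pdivrMr ?mul1r ?ltr_wpDl// lerDl.
rewrite /B in sB.
have se : s * (e / (2 * s)) = e / 2 by field; rewrite gt_eqF.
have {wf}: s * normsq Om (fun x => w x - f x) < e / 2 by rewrite -se ltr_pM2l.
have {hk}: s * normsq Om (fun x => h x - k x) < e / 2 by rewrite -se ltr_pM2l.
lra.
Qed.

(** The imaginary parts agree by the real case for [i F] and [i G]. *)
Lemma inner_op_closure T w h F G :
  (forall f k, T f k -> L2 f /\ L2 k) -> op_closure Om T w h -> L2 F -> L2 G ->
  (forall f k, T f k -> << k, F >> = << f, G >>) -> << h, F >> = << w, G >>.
Proof.
move=> TL2 Twh L2F L2G TFG; have [L2w L2h _] := Twh.
apply: complex_eq; first exact: Re_inner_op_closure TL2 Twh _ _ _.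
have := Re_inner_op_closure TL2 Twh (in_L2Z mOm (Complex 0 1) L2F)
  (in_L2Z mOm (Complex 0 1) L2G).
rewrite !innerZr// !partsE/= !mul0r !sub0r !mulN1r !opprK; apply => f k Tfk.
by have [L2f L2k] := TL2 _ _ Tfk; rewrite !innerZr// (TFG _ _ Tfk).
Qed.

Lemma op_closure_refl T f h : L2 f -> L2 h -> T f h -> op_closure Om T f h.
Proof.
move=> L2f L2h Tfh; split => // e e0; exists f, h; split => //.
  rewrite /sqnorm; under eq_integral do rewrite subrr sqmod0.
  by rewrite integral0 lte_fin.
rewrite /sqnorm; under eq_integral do rewrite subrr sqmod0.
by rewrite integral0 lte_fin.
Qed.

Lemma in_L2_waveM t i f : L2 f -> L2 (fun x => plane_wave t i x * f x).
Proof.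
move=> L2f; have [mf _] := L2f; apply: (in_L2_dominated mOm (c := 1) _ L2f).
  exact: (cmeasurableM (cmeasurable_plane_wave _ _ _)).
by move=> x; rewrite sqmodM sqmod_plane_wave.
Qed.

Lemma inner_waveMl t i f g :
  << fun x => plane_wave t i x * f x, g >> =
  << f, fun x => plane_wave (- t) i x * g x >>.
Proof.
rewrite /inner; congr cintegral; apply/funext => x.
rewrite -conj_plane_wave; apply: complex_eq; rewrite !partsE; ring.
Qed.

Variables (V : E -> R).
Local Notation H := (fun phi x => - laplacian phi x + Complex (V x) 0 * phi x).
Local Notation TH := (schrodinger Om V).
Hypothesis esa : essentially_self_adjoint Om TH.

Lemma schrodinger_in_L2 phi : test_function Om phi -> L2 phi /\ L2 (H phi).
Proof. by move=> tphi; apply: esa.1. Qed.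

(** Self-adjointness puts [(v, h)] in the adjoint of the closure, and the closure contains all test
    functions. *)
Lemma schrodinger_symmetric v h phi : op_closure Om TH v h ->
  test_function Om phi -> << H phi, v >> = << phi, h >>.
Proof.
move=> /esa.2 [_ _ Tvh] tphi; apply: Tvh; have [? ?] := schrodinger_in_L2 tphi.
exact: op_closure_refl.
Qed.

(* The value of [H, e_t] v, where g stands for the i-th derivative of v. *)
Definition wave_commutator t (i : 'I_d) v g : E -> C := fun x =>
  plane_wave t i x * (Complex (t ^+ 2) 0 * v x - Complex 0 (2 * t) * g x).

Lemma in_L2_wave_commutator t i v g : L2 v -> L2 g ->
  L2 (wave_commutator t i v g).
Proof.
move=> L2v L2g; apply: in_L2_waveM.
by apply: in_L2B => //; exact: in_L2Z.
Qed.

(* With psi = e_{-t} phi, test the symmetry of H and the weak gradient of v on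
   psi.  The derivative of psi is square-integrable because it is a combination
   of H psi, e_{-t} H phi and psi. *)
Lemma inner_schrodinger_wave (lam : R) t i v (g : 'I_d -> E -> C) phi : t != 0 ->
  op_closure Om TH v (fun x => Complex lam 0 * v x) ->
  weak_gradient Om v g -> L2 (g i) -> test_function Om phi ->
  << H phi, fun x => plane_wave t i x * v x >> =
  << phi, fun x => Complex lam 0 * (plane_wave t i x * v x) +
                   wave_commutator t i v (g i) x >>.
Proof.
move=> t0 Tv [_ wg] L2g tphi; have [L2v L2lv _] := Tv.
have [sphi _ _] := tphi; have [L2phi L2Hphi] := schrodinger_in_L2 tphi.
pose psi x := plane_wave (- t) i x * phi x.
have tpsi : test_function Om psi by exact: test_function_waveM.
have [spsi _ _] := tpsi; have [L2psi L2Hpsi] := schrodinger_in_L2 tpsi.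
pose P x : C := Complex 0 (2 * t) * partial_deriv i psi x.
(* The commutator formula for [e_{-t}], solved for the derivative of [psi]. *)
have PE : P = fun x => H psi x - plane_wave (- t) i x * H phi x +
    Complex (t ^+ 2) 0 * psi x.
  apply/funext => x; rewrite /P /psi laplacian_waveM//.
  rewrite partial_deriv_waveM; last exact: smooth_cdifferentiable.
  rewrite /wave_coef eqxx mulr1 sqrrN.
  have -> : Complex 0 (2 * t) = 2 * Complex 0 t :> C.
    by apply: complex_eq; rewrite !partsE/=; ring.
  have -> : Complex 0 (- t) = - Complex 0 t :> C.
    by apply: complex_eq; rewrite !partsE/= ?oppr0.
  have -> : Complex (t ^+ 2) 0 = - (Complex 0 t * Complex 0 t) :> C.
    by apply: complex_eq; rewrite !partsE/=; ring.
  by ring.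
have L2eH := in_L2_waveM (- t) i L2Hphi.
have L2tpsi := in_L2Z mOm (Complex (t ^+ 2) 0) L2psi.
have L2d := in_L2B mOm L2Hpsi L2eH.
have L2P : L2 P by rewrite PE; exact: in_L2D.
have L2dpsi : L2 (partial_deriv i psi).
  have := in_L2Z mOm (Complex 0 (2 * t))^-1 L2P.
  congr in_L2; apply/funext => x; rewrite /P mulKf//.
  by apply/eqP => /(congr1 (@complex.Im R)) /= /eqP; rewrite mulf_eq0 (negbTE t0) orbF pnatr_eq0.
(* The weak gradient is tested on the conjugate of [psi], since the inner product conjugates its
   second argument. Its minus sign cancels the one from conjugating [2 i t]. *)
have vP : << v, P >> = Complex 0 (2 * t) * << g i, psi >>.
  rewrite innerZr//.
  have -> : << v, partial_deriv i psi >> = - << g i, psi >>.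
    have [_ /(_ _ (test_function_conj tpsi))] := wg i.
    rewrite /inner => <-; congr cintegral; apply/funext => x.
    by rewrite partial_deriv_conj//; exact: smooth_cdifferentiable.
  by apply: complex_eq; rewrite !partsE/=; ring.
have Pv : << P, v >> = - Complex 0 (2 * t) * << psi, g i >>.
  rewrite (inner_conj mOm L2v L2P) vP (inner_conj mOm L2g L2psi).
  by apply: complex_eq; rewrite !partsE/=; ring.
(* Inserting the formula for [P]: symmetry moves [H] from [psi] to the eigenfunction, and the middle
   term is the wanted pairing of [H phi] with [e_t v]. *)
have := Pv; rewrite PE innerDl// innerBl// (schrodinger_symmetric Tv tpsi).
rewrite inner_waveMl opprK !innerZl// !innerZr// => eq1.
have L2ev := in_L2_waveM t i L2v.
have L2eg := in_L2_waveM t i L2g.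
have -> : (fun x => Complex lam 0 * (plane_wave t i x * v x) +
    wave_commutator t i v (g i) x) = fun x =>
  Complex (lam + t ^+ 2) 0 * (plane_wave t i x * v x) +
  - Complex 0 (2 * t) * (plane_wave t i x * g i x).
  apply/funext => x; rewrite /wave_commutator.
  by apply: complex_eq; rewrite !partsE/=; ring.
have L2ev' := in_L2Z mOm (Complex (lam + t ^+ 2) 0) L2ev.
have L2eg' := in_L2Z mOm (- Complex 0 (2 * t)) L2eg.
rewrite innerDr// !innerZr//.
have psiE f : << psi, f >> = << phi, fun x => plane_wave t i x * f x >>.
  by rewrite /psi inner_waveMl opprK.
rewrite -!psiE; move: eq1.
move: << _, fun x => plane_wave t i x * v x >> << psi, v >> << psi, g i >>.
move=> X Y G eq1.
have -> : X = conjc (Complex lam 0) * Y + Complex (t ^+ 2) 0 * Y -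
    - Complex 0 (2 * t) * G by rewrite -eq1; ring.
by apply: complex_eq; rewrite !partsE/=; ring.
Qed.

(** Matrix elements of the commutator between eigenfunctions. [inner_schrodinger_wave] gives the
    action of [H] on [e_t v] against test functions, and [inner_op_closure] extends it to pairings
    with [w]. *)
Lemma inner_wave_commutator (lam kap : R) t i v w (g : 'I_d -> E -> C) :
  t != 0 ->
  op_closure Om TH v (fun x => Complex lam 0 * v x) ->
  op_closure Om TH w (fun x => Complex kap 0 * w x) ->
  weak_gradient Om v g -> L2 (g i) ->
  << wave_commutator t i v (g i), w >> =
  Complex (kap - lam) 0 * << fun x => plane_wave t i x * v x, w >>.
Proof.
move=> t0 Tv Tw wg L2g; have [L2v _ _] := Tv; have [L2w _ _] := Tw.
have L2ev := in_L2_waveM t i L2v.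
have L2lev := in_L2Z mOm (Complex lam 0) L2ev.
have L2K := in_L2_wave_commutator t i L2v L2g.
have := inner_op_closure esa.1 Tw L2ev (in_L2D mOm L2lev L2K).
rewrite innerZl// innerDr// innerZr// => eq1.
rewrite (inner_conj mOm L2w L2K) (inner_conj mOm L2w L2ev).
move: eq1; move: << w, _ >> << w, _ >> => X Y eq1.
have -> : X = Complex kap 0 * Y - conjc (Complex lam 0) * Y.
  rewrite eq1; first by ring.
  by move=> f k [tf ->]; exact: (inner_schrodinger_wave t0 Tv wg L2g tf).
by apply: complex_eq; rewrite !partsE/=; ring.
Qed.

End Commutator.

(** * Sum rules *)

Section SumRules.
Variables (R : realType) (d : nat) (Om : set 'rV[R]_d).
Hypothesis mOm : measurable Om.
Local Notation E := 'rV[R]_d.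
Local Notation C := R[i].
Local Notation L2 := (in_L2 Om).
Local Notation N := (normsq Om).
Local Notation "<< f , g >>" := (inner Om f g).
Variables (V : E -> R) (lam : nat -> R) (u : nat -> E -> C).
Variables (Du : nat -> 'I_d -> E -> C).
Local Notation TH := (schrodinger Om V).
Hypothesis esa : essentially_self_adjoint Om TH.
Hypothesis eig : eigenbasis Om (op_closure Om TH) lam u.
Hypothesis wg : forall k, weak_gradient Om (u k) (Du k).
Hypothesis L2Du : forall k i, L2 (Du k i).
Implicit Types (t : R) (i : 'I_d) (j k : nat) (v g : E -> C).

(* Both signs of t are needed for symmetry in j and k. *)
Definition wave_weight t i j k : R :=
  sqmod << fun x => plane_wave t i x * u j x, u k >> +
  sqmod << fun x => plane_wave (- t) i x * u j x, u k >>.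

Lemma wave_weight_ge0 t i j k : 0 <= wave_weight t i j k.
Proof. by rewrite addr_ge0// sqmod_ge0. Qed.

Lemma wave_weight_sym t i j k : wave_weight t i j k = wave_weight t i k j.
Proof.
have [_ [L2u _] _] := eig.
have S s a b : sqmod << fun x => plane_wave s i x * u a x, u b >> =
    sqmod << fun x => plane_wave (- s) i x * u b x, u a >>.
  rewrite inner_waveMl (inner_conj mOm _ (L2u a)) ?sqmod_conj//.
  exact: in_L2_waveM.
by rewrite /wave_weight addrC (S t) (S (- t)) opprK.
Qed.

Lemma inner_wave_wave_commutator t i v g :
  << fun x => plane_wave t i x * v x, wave_commutator t i v g >> =
  << v, fun x => Complex (t ^+ 2) 0 * v x - Complex 0 (2 * t) * g x >>.
Proof.
rewrite inner_waveMl; congr inner; apply/funext => x.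
by rewrite /wave_commutator mulrA [_ * plane_wave t i x]mulrC plane_waveK mul1r.
Qed.

(** One factor [lam k - lam j] turns a coefficient of [e_t u_j] into one of the commutator, so
    Parseval sums the series. The sum for one sign of [t] is [t ^ 2] minus a term odd in [t], which
    cancels against the other sign. *)
Lemma wave_weight_sum1 t i j : t != 0 ->
  \sum_(k < n) (lam k - lam j) * wave_weight t i j k @[n --> \oo] --> 2 * t ^+ 2.
Proof.
have [Tu on cpl] := eig; have [L2u _] := on => t0.
have L2e s := in_L2_waveM mOm s i (L2u j).
have L2K s := in_L2_wave_commutator mOm s i (L2u j) (L2Du j i).
have cv s := parseval_inner mOm on cpl (L2e s) (L2K s).
have -> : 2 * t ^+ 2 =
    complex.Re << fun x => plane_wave t i x * u j x,
                  wave_commutator t i (u j) (Du j i) >> +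
    complex.Re << fun x => plane_wave (- t) i x * u j x,
                  wave_commutator (- t) i (u j) (Du j i) >>.
  rewrite !inner_wave_wave_commutator.
  have L2Z c f : L2 f -> L2 (fun x => c * f x) by exact: in_L2Z.
  have I s : complex.Re << u j, fun x => Complex (s ^+ 2) 0 * u j x -
        Complex 0 (2 * s) * Du j i x >> =
      s ^+ 2 - 2 * s * complex.Im << u j, Du j i >>.
    under [X in inner _ _ X]eq_fun do rewrite -mulNr.
    rewrite innerDr// ?innerZr//; [|exact: L2Z..].
    rewrite (inner_self mOm (L2u j)) (normsq_basis on) !partsE/=; ring.
  by rewrite !I sqrrN; ring.
have E n : \sum_(k < n) (lam k - lam j) * wave_weight t i j k =
   \sum_(k < n) complex.Re (<< fun x => plane_wave t i x * u j x, u k >> *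
     conjc << wave_commutator t i (u j) (Du j i), u k >>) +
   \sum_(k < n) complex.Re (<< fun x => plane_wave (- t) i x * u j x, u k >> *
     conjc << wave_commutator (- t) i (u j) (Du j i), u k >>).
  rewrite /wave_weight; under eq_bigr do rewrite mulrDr.
  have K k s (s0 : s != 0) :=
    inner_wave_commutator mOm esa s0 (Tu j) (Tu k) (wg j) (L2Du j i).
  by rewrite big_split; congr (_ + _); apply: eq_bigr => k _;
    rewrite K ?oppr_eq0//; move: << _, _ >> => a; rewrite /sqmod !partsE/=; ring.
under eq_fun do rewrite E.
exact: cvgD.
Qed.

(** The sums are those of the squared coefficients of the commutators, bounded by Bessel. The cubic
    term of the squared norm is odd in [t] and cancels between the two signs. *)
Lemma wave_weight_sum2 t i j n : t != 0 ->
  \sum_(k < n) (lam k - lam j) ^+ 2 * wave_weight t i j k <=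
  2 * t ^+ 2 * (t ^+ 2 + 4 * N (Du j i)).
Proof.
have [Tu on cpl] := eig; have [L2u _] := on => t0.
have L2K s := in_L2_wave_commutator mOm s i (L2u j) (L2Du j i).
have B s := bessel mOm on n (L2K s).
have L2Z c f : L2 f -> L2 (fun x => c * f x) by exact: in_L2Z.
have NK s : N (wave_commutator s i (u j) (Du j i)) =
    s ^+ 4 + 4 * s ^+ 2 * N (Du j i) -
    4 * s ^+ 3 * complex.Im << u j, Du j i >>.
  transitivity (N (fun x => Complex (s ^+ 2) 0 * u j x +
      - Complex 0 (2 * s) * Du j i x)).
    rewrite !normsqE; apply: eq_Rintegral => x _.
    by rewrite /wave_commutator sqmodM sqmod_plane_wave mul1r mulNr.
  rewrite normsqD//; [|exact: L2Z..].
  rewrite !normsqZ// (normsq_basis on) innerZl ?innerZr//; last exact: L2Z.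
  by rewrite /sqmod !partsE/=; ring.
have E : \sum_(k < n) (lam k - lam j) ^+ 2 * wave_weight t i j k =
   \sum_(k < n) sqmod << wave_commutator t i (u j) (Du j i), u k >> +
   \sum_(k < n) sqmod << wave_commutator (- t) i (u j) (Du j i), u k >>.
  rewrite /wave_weight; under eq_bigr do rewrite mulrDr.
  have K k s (s0 : s != 0) :=
    inner_wave_commutator mOm esa s0 (Tu j) (Tu k) (wg j) (L2Du j i).
  by rewrite big_split; congr (_ + _); apply: eq_bigr => k _;
    rewrite K ?oppr_eq0//; move: << _, _ >> => a; rewrite /sqmod !partsE/=; ring.
rewrite E; apply: le_trans (lerD (B t) (B (- t))) _.
by rewrite !NK le_eqVlt; apply/orP; left; apply/eqP; ring.
Qed.

(** Both sum rules carry the factor [2 * t ^ 2]. Dividing by it leaves an error [c * t ^ 2 * S], and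
    the limit [t -> 0] is replaced by a choice of [t] for each [e]. *)
Lemma riesz_sum_gradient_le (r c z : R) i n : 1 < r -> 1 <= c ->
  (forall x y : R, 0 <= y -> y <= x -> x `^ r - y `^ r <=
     c * (x `^ (r - 1) + y `^ (r - 1)) * (x - y)) ->
  (forall k, (n <= k)%N -> z <= lam k) ->
  \sum_(j < n) posR_pow r (z - lam j) <=
  4 * c * \sum_(j < n) posR_pow (r - 1) (z - lam j) * N (Du j i).
Proof.
move=> r1 c1 Hc zlam; apply/ler_addgt0Pr => e e0.
pose S := \sum_(j < n) posR_pow (r - 1) (z - lam j).
have S0 : 0 <= S by rewrite sumr_ge0// => j _; exact: posR_pow_ge0.
have cS0 : 0 <= c * S by rewrite mulr_ge0// (le_trans ler01).
(* Makes [c * t ^ 2 * S <= e]; the [+ 1] keeps the denominator positive if [S = 0]. *)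
pose t := Num.sqrt (e / (c * S + 1)).
have et0 : 0 < e / (c * S + 1) by rewrite divr_gt0// ltr_wpDl.
have t0 : 0 < t by rewrite sqrtr_gt0.
have t2 : t ^+ 2 = e / (c * S + 1) by rewrite sqr_sqrtr// ltW.
have tn0 : t != 0 by rewrite gt_eqF.
have := riesz_sum_le r1 c1 Hc (wave_weight_ge0 t i) (wave_weight_sym t i)
  (fun j => wave_weight_sum1 i j tn0) (fun j m => wave_weight_sum2 i j m tn0) zlam.
have -> : \sum_(j < n) posR_pow (r - 1) (z - lam j) *
    (2 * t ^+ 2 * (t ^+ 2 + 4 * N (Du j i))) =
    2 * t ^+ 2 * (t ^+ 2 * S + 4 *
      \sum_(j < n) posR_pow (r - 1) (z - lam j) * N (Du j i)).
  rewrite mulr_sumr mulr_sumr -big_split mulr_sumr; apply: eq_bigr => j _ /=.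
  by ring.
rewrite [leRHS]mulrCA ler_pM2l; last by rewrite mulr_gt0// exprn_gt0.
move=> /le_trans; apply; rewrite mulrDr addrC mulrA lerD//; first by lra.
rewrite t2 mulrCA mulrAC ler_pdivrMr ?ltr_wpDl//.
by rewrite ler_pM2l// lerDl.
Qed.

End SumRules.

(** * The kinetic energy as a sum of squared norms *)

Section KineticEnergy.
Variables (R : realType) (d : nat) (Om : set 'rV[R]_d).
Hypothesis mOm : measurable Om.
Implicit Types g : 'I_d -> 'rV[R]_d -> R[i].

Lemma kinetic_energyE g : (forall i, in_L2 Om (g i)) ->
  kinetic_energy Om g = (\sum_(i < d) normsq Om (g i))%:E.
Proof.
move=> L2g; rewrite -sumEFin.
under [RHS]eq_bigr do rewrite -sqnormE//.
rewrite -ge0_integral_sum//=.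
- by rewrite /kinetic_energy; under eq_integral do rewrite -sumEFin.
- by move=> i; apply/measurable_EFinP; apply: measurable_sqmod; have [] := L2g i.
- by move=> i x _; rewrite lee_fin sqmod_ge0.
Qed.

Lemma kinetic_energy_in_L2 g i : (forall j, cmeasurable Om (g j)) ->
  (kinetic_energy Om g < +oo)%E -> in_L2 Om (g i).
Proof.
move=> mg; split; first exact: mg.
apply: le_lt_trans (_ : (sqnorm Om (g i) <= kinetic_energy Om g)%E) _ => //.
have msq j : measurable_fun Om (fun x => sqmod (g j x)).
  exact: measurable_sqmod.
apply: ge0_le_integral => //.
- by move=> x _; rewrite lee_fin sqmod_ge0.
- exact/measurable_EFinP.
- by apply/measurable_EFinP; exact: measurable_sum.
move=> x _; rewrite lee_fin (bigD1 i)//= lerDl sumr_ge0// => j _.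
exact: sqmod_ge0.
Qed.

End KineticEnergy.

Lemma posR_pow_mulr (R : realType) (r x : R) : 1 < r ->
  x * posR_pow (r - 1) x = posR_pow r x.
Proof.
move=> r1; have r0 : 0 < r by lra. have r10 : 0 < r - 1 by lra.
have [x0|x0] := leP x 0; first by rewrite !posR_pow0// mulr0.
by rewrite !posR_powE ?(ltW x0)// mulr_powRB1// ltW.
Qed.

(** * The differential inequality for Riesz means and the sign of [sigma] *)

Section RieszInequality.
Variables (R : realType) (d : nat) (Om : set 'rV[R]_d) (V : 'rV[R]_d -> R).
Variables (lam : nat -> R) (u : nat -> 'rV[R]_d -> R[i]).
Variables (Du : nat -> 'I_d -> 'rV[R]_d -> R[i]) (sigma : R).
Hypothesis d0 : (0 < d)%N.
Hypothesis oOm : open Om.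
Hypothesis esa : essentially_self_adjoint Om (schrodinger Om V).
Hypothesis eig : eigenbasis Om (op_closure Om (schrodinger Om V)) lam u.
Hypothesis lamy : lam k @[k --> \oo] --> +oo.
Hypothesis wg : forall k, weak_gradient Om (u k) (Du k).
Hypothesis kin : forall k, (kinetic_energy Om (Du k) <= (sigma * lam k)%:E)%E.

Let mOm : measurable Om := open_measurable_rV oOm.

Let L2Du k i : in_L2 Om (Du k i).
Proof.
apply: kinetic_energy_in_L2 => //; last exact: le_lt_trans (kin k) (ltry _).
by move=> j; have [_ /(_ j)[[]]] := wg k.
Qed.

Let sum_normsq_le k : \sum_(i < d) normsq Om (Du k i) <= sigma * lam k.
Proof. by rewrite -lee_fin -kinetic_energyE. Qed.

(** Summing the gradient bound over the [d] directions produces the kinetic energies, at most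
    [sigma * lam j]. *)
Lemma riesz_mean_le (r c z : R) : 1 < r -> 1 <= c ->
  (forall x y : R, 0 <= y -> y <= x -> x `^ r - y `^ r <=
     c * (x `^ (r - 1) + y `^ (r - 1)) * (x - y)) ->
  d%:R * riesz_mean lam r z <= 4 * c * sigma *
    (z * riesz_mean lam (r - 1) z - riesz_mean lam r z).
Proof.
move=> r1 c1 Hc; have [n zlam] := cvg_pinfty_ge z lamy.
rewrite !(riesz_meanE _ zlam); try lra.
(* Splitting one factor [z - lam k] off the power [r] makes the terms in [z] cancel. *)
have -> : z * \sum_(k < n) posR_pow (r - 1) (z - lam k) -
    \sum_(k < n) posR_pow r (z - lam k) =
    \sum_(k < n) posR_pow (r - 1) (z - lam k) * lam k.
  rewrite mulr_sumr -sumrB; apply: eq_bigr => k _.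
  by rewrite -(posR_pow_mulr _ r1); ring.
rewrite mulr_natl -[in X in _ *+ X](card_ord d) -sumr_const.
apply: le_trans (ler_sum _ (fun i _ =>
  riesz_sum_gradient_le mOm esa eig wg L2Du i r1 c1 Hc zlam)) _.
rewrite -mulr_sumr exchange_big/= -mulrA ler_wpM2l//; first by lra.
rewrite mulr_sumr; apply: ler_sum => j _.
by rewrite -mulr_sumr mulrCA ler_wpM2l// posR_pow_ge0.
Qed.

(** The theorem divides by [sigma]. Kinetic energies are nonnegative, so [sigma < 0] fails once
    [lam k >= 1]. If [sigma = 0], the mean of order 2 at [lam 0 + 1] would be nonpositive, although
    its term of index 0 equals 1. *)
Lemma sigma_gt0 : 0 < sigma.
Proof.
have T0 k : 0 <= sigma * lam k.
  apply: le_trans (sum_normsq_le k); rewrite sumr_ge0// => i _.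
  exact: normsq_ge0.
rewrite ltNge le_eqVlt; apply/negP => /orP[/eqP s0|s0]; last first.
  have [n /(_ n (leqnn _)) l1] := cvg_pinfty_ge 1 lamy.
  have := T0 n; rewrite nmulr_rge0// => l0.
  lra.
have := @riesz_mean_le 2 (2 / 2) (lam 0 + 1).
rewrite divff// => /(_ _ (lexx _)) H.
have : d%:R * riesz_mean lam 2 (lam 0 + 1) <= 0.
  move: H; rewrite s0 mulr0 mul0r; apply; first by lra.
  move=> x y y0 yx; have := powR_trapezoid (lexx 2) y0 yx.
  by rewrite divff.
apply/negP; rewrite -ltNge mulr_gt0 ?ltr0n//.
have [n zlam] := cvg_pinfty_ge (lam 0 + 1) lamy.
have n0 : (0 < n)%N.
  by rewrite lt0n; apply/eqP => n0; have := zlam 0; rewrite n0 => /(_ isT); lra.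
rewrite (riesz_meanE _ zlam)// (bigD1 (Ordinal n0))//= ltr_pwDl//.
  by rewrite addrAC subrr add0r posR_powE// powR1.
by rewrite sumr_ge0// => k _; exact: posR_pow_ge0.
Qed.

End RieszInequality.


Theorem theorem2p6 (R : realType) (d : nat) (Om : set 'rV[R]_d)
    (V : 'rV[R]_d -> R) (lam : nat -> R) (u : nat -> 'rV[R]_d -> R[i])
    (Du : nat -> 'I_d -> 'rV[R]_d -> R[i]) (sigma : R) :
  (0 < d)%N ->
  open Om -> connected Om -> Om !=set0 ->
  essentially_self_adjoint Om (schrodinger Om V) ->
  purely_discrete_spectrum Om (op_closure Om (schrodinger Om V)) ->
  eigenbasis Om (op_closure Om (schrodinger Om V)) lam u ->
  {homo lam : j k / (j <= k)%N >-> j <= k} ->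
  lam k @[k --> \oo] --> +oo ->
  (forall k, weak_gradient Om (u k) (Du k)) ->
  (forall k, (kinetic_energy Om (Du k) <= (sigma * lam k)%:E)%E) ->
  (forall rho : R, 2 <= rho ->
    (forall z, 0 <= z ->
      riesz_mean lam rho z <=
        rho / (rho + d%:R / (2 * sigma)) * z * riesz_mean lam (rho - 1) z) /\
    {in `]0, +oo[ &, {homo (fun z => riesz_mean lam rho z /
        z `^ (rho + d%:R / (2 * sigma))) : y z / y <= z}}) /\
  (forall rho : R, 1 < rho <= 2 ->
    (forall z, 0 <= z ->
      riesz_mean lam rho z <=
        1 / (1 + d%:R / (4 * sigma)) * z * riesz_mean lam (rho - 1) z) /\
    {in `]0, +oo[ &, {homo (fun z => riesz_mean lam rho z /
        z `^ (rho + d%:R * rho / (4 * sigma))) : y z / y <= z}}).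
Proof.
move=> d0 oOm _ _ esa _ eig _ lamy wg kin.
have sg0 := sigma_gt0 d0 oOm esa eig lamy wg kin.
have dR : 0 < d%:R :> R by rewrite ltr0n.
have le r c := @riesz_mean_le R d Om V lam u Du sigma oOm esa eig lamy wg kin r c.
split=> rho => [r2|r12].
- have r1 : 1 < rho by lra.
  have p0 : 0 < d%:R / (2 * sigma) by rewrite divr_gt0 ?mulr_gt0.
  have a0 : 0 < rho / (rho + d%:R / (2 * sigma)).
    by rewrite divr_gt0//; lra.
  have main z : 0 <= z -> riesz_mean lam rho z <=
      rho / (rho + d%:R / (2 * sigma)) * z * riesz_mean lam (rho - 1) z.
    (* With [c = rho / 2] the bound reads [d * X <= 2 * rho * sigma * (z * Y - X)]; collecting [X]
       and dividing by [2 * sigma] gives the claim. *)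
    move=> z0; have := le rho (rho / 2) z r1 ltac:(lra)
      (fun x y => @powR_trapezoid R rho x y r2).
    set X := riesz_mean _ _ _; set Y := riesz_mean _ _ _.
    set q := rho + d%:R / (2 * sigma) => H.
    have q0 : 0 < q by rewrite /q; lra.
    have -> : rho / q * z * Y = rho * z * Y / q by ring.
    rewrite ler_pdivlMr// -(ler_pM2l (mulr_gt0 (ltr0Sn R 1) sg0)).
    have -> : 2 * sigma * (X * q) = 2 * sigma * rho * X + d%:R * X.
      by rewrite /q; field; rewrite gt_eqF.
    by lra.
  split=> //.
  (* The exponent is [rho] divided by the constant of the inequality just proved. *)
  have -> : rho + d%:R / (2 * sigma) = rho / (rho / (rho + d%:R / (2 * sigma))).
    by rewrite invf_div [RHS]mulrC divfK // gt_eqF//; lra.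
  exact: riesz_mean_ratio_nondecreasing.
- have /andP[r1 r2] := r12.
  have p0 : 0 < d%:R / (4 * sigma) by rewrite divr_gt0 ?mulr_gt0.
  have a0 : 0 < 1 / (1 + d%:R / (4 * sigma)).
    by rewrite divr_gt0//; lra.
  have main z : 0 <= z -> riesz_mean lam rho z <=
      1 / (1 + d%:R / (4 * sigma)) * z * riesz_mean lam (rho - 1) z.
    have Hc x y : 0 <= y -> y <= x -> x `^ rho - y `^ rho <=
        1 * (x `^ (rho - 1) + y `^ (rho - 1)) * (x - y).
      by rewrite mul1r; exact: powR_sub_le.
    (* Here [c = 1], so [d * X <= 4 * sigma * (z * Y - X)]. *)
    move=> z0; have := le rho 1 z r1 (lexx _) Hc.
    set X := riesz_mean _ _ _; set Y := riesz_mean _ _ _.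
    set q := 1 + d%:R / (4 * sigma) => H.
    have q0 : 0 < q by rewrite /q; lra.
    have -> : 1 / q * z * Y = z * Y / q by ring.
    rewrite ler_pdivlMr// -(ler_pM2l (mulr_gt0 (ltr0Sn R 3) sg0)).
    have -> : 4 * sigma * (X * q) = 4 * sigma * X + d%:R * X.
      by rewrite /q; field; rewrite gt_eqF.
    by lra.
  split=> //.
  have -> : rho + d%:R * rho / (4 * sigma) =
      rho / (1 / (1 + d%:R / (4 * sigma))).
    by rewrite invf_div divr1; ring.
  exact: riesz_mean_ratio_nondecreasing.
Qed.
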